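(* Assume $( * )$, i.e. work in ZF + DC + ''every subset of $2^{\omega}$ has the Baire property''. Let $\mathrm{HEG}$ be the Hawaiian earring group, let $\mathrm{BD}\leq\mathrm{HEG}$ be the subgroup of elements whose reduced word representative uses each letter a uniformly bounded number of times, and let $\mathrm{SCAT}\leq\mathrm{HEG}$ be the subgroup of elements whose reduced word representative has domain of scattered order type. Then neither $\mathrm{BD}$ nor $\mathrm{SCAT}$ is a free group.
   Context: $( * )$ denotes the theory ZF + DC + ''every subset of the Cantor space $2^{\omega}=\{0,1\}^{\omega}$ (product topology) has the Baire property''; the full axiom of choice is not assumed. DC is the axiom of dependent choice: if $R$ is a binary relation on a nonempty set $X$ with $(\forall x)(\exists y)(xRy)$, then there is a sequence $(z_n)_{n\in\omega}$ with $z_nRz_{n+1}$ for all $n$. A subset $Y$ of a space $X$ has the Baire property if there is an open $U\subseteq X$ such that $Y\Delta U$ is meager in $X$. Hawaiian earring group. Let $\{a_n^{\pm1}\}_{n\in\omega}$ be a countably infinite set with formal inverses. A word is a function $W:\overline{W}\rightarrow\{a_n^{\pm1}\}_{n\in\omega}$ from a countable (possibly finite or empty) totally ordered set $\overline{W}$ such that for each $n\in\omega$ the set $W^{-1}(\{a_n^{\pm1}\})$ is finite. Write $U\equiv V$ if there is an order isomorphism $f:\overline{U}\rightarrow\overline{V}$ with $U(i)=V(f(i))$ for all $i\in \overline{U}$; words are considered up to $\equiv$, and $\mathcal{W}$ denotes the set of words so considered. For $N\in\omega$ let $p_N(W)=W\upharpoonright\{i\in\overline{W}: W(i)\in\{a_n^{\pm1}\}_{n=0}^N\}$,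 a finite word. For $U,V\in\mathcal{W}$ let $U\sim V$ if for each $N\in\omega$ one has $p_N(U)=p_N(V)$ in the free group $F(\{a_0,\ldots,a_N\})$. For words $U,V$, the concatenation $UV$ has as domain the disjoint union of $\overline{U}$ and $\overline{V}$, ordered by extending the two orders and placing all elements of $\overline{U}$ before those of $\overline{V}$, with values given by $U$ and $V$; $U^{-1}$ has domain $\overline{U}$ with reversed order and $U^{-1}(i)=(U(i))^{-1}$. The group $\mathrm{HEG}$ is $\mathcal{W}/\sim$ with $[U][V]=[UV]$, $[U]^{-1}=[U^{-1}]$ and identity the class of the empty word $E$. A word $W$ is reduced if $W\equiv UVX$ with $V\sim E$ implies $V\equiv E$. Each class in $\mathrm{HEG}$ has a unique (up to $\equiv$) reduced representative. $\mathrm{BD}$ consists of those elements $[W]\in\mathrm{HEG}$ for whose reduced word representative $W$ there exists $N\in\omega$ such that for every $n\in\omega$, $|\{i\in\overline{W}: W(i)\in\{a_n^{\pm1}\}\}|<N$. $\mathrm{SCAT}$ consists of those elements of $\mathrm{HEG}$ whose reduced word representative has domain of scattered order type, i.e. containing no densely ordered subset with more than one element. *)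

(* Defs.v *)
(* The theory ZF + DC + "every subset of Cantor space has the Baire property"
   refutes the axiom of choice, so the
   theory is not assumed of the ambient logic, where choice may be available.
   Instead [M] with [E] is an arbitrary first-order structure for the language
   of set theory, and every mathematical notion is relativised to it.  Each
   predicate is a first-order formula over [(M, E)]: its quantifiers range over
   [M] only, and an argument of type [M -> Prop] always stands for another such
   formula.  That every structure satisfying the theory satisfies the conclusion
   is, by completeness, the provability of the conclusion in the theory. *)

Set Implicit Arguments.
Unset Strict Implicit.
Unset Printing Implicit Defensive.

(* Formulas, with de Bruijn variables, for the two axiom schemes. *)
Inductive formula : Type :=
| FMem (i j : nat)
| FEq (i j : nat)
| FNot (p : formula)
| FAnd (p q : formula)
| FOr (p q : formula)
| FImp (p q : formula)
| FAll (p : formula)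
| FEx (p : formula).

Definition scons (M : Type) (x : M) (env : nat -> M) (n : nat) : M :=
  match n with O => x | S k => env k end.

Fixpoint sat (M : Type) (E : M -> M -> Prop) (env : nat -> M) (p : formula)
    : Prop :=
  match p with
  | FMem i j => E (env i) (env j)
  | FEq i j => env i = env j
  | FNot p => ~ sat E env p
  | FAnd p q => sat E env p /\ sat E env q
  | FOr p q => sat E env p \/ sat E env q
  | FImp p q => sat E env p -> sat E env q
  | FAll p => forall x, sat E (scons x env) p
  | FEx p => exists x, sat E (scons x env) p
  end.

Section InsideModel.

Context (M : Type) (E : M -> M -> Prop).

Local Notation "x 'in_' y" := (E x y) (at level 70).

(** Basic set theory *)

Definition elts (a : M) : M -> Prop := fun x => x in_ a.

Definition is_set_of (P : M -> Prop) (a : M) := forall x, x in_ a <-> P x.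

Definition sub_class (P Q : M -> Prop) := forall x, P x -> Q x.

Definition is_empty (a : M) := forall x, ~ x in_ a.

Definition is_succ (s n : M) := forall x, x in_ s <-> x in_ n \/ x = n.

Definition inductive_set (a : M) :=
  (forall e, is_empty e -> e in_ a) /\
  (forall n s, n in_ a -> is_succ s n -> s in_ a).

Definition omega (n : M) := forall a, inductive_set a -> n in_ a.

(* Kuratowski pairs *)
Definition upair (p x y : M) := forall t, t in_ p <-> t = x \/ t = y.

Definition opair (p x y : M) :=
  exists a b, upair a x x /\ upair b x y /\ upair p a b.

(* [(x, y)] belongs to [r]; for a function [r], this says [r(x) = y]. *)
Definition rel (r x y : M) := exists p, opair p x y /\ p in_ r.

Definition prod_class (A B : M -> Prop) (p : M) :=
  exists x y, A x /\ B y /\ opair p x y.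

Definition func (f : M) (A B : M -> Prop) :=
  sub_class (elts f) (prod_class A B) /\
  (forall x, A x -> exists! y, rel f x y).

Definition bij (f : M) (A B : M -> Prop) :=
  func f A B /\ (forall y, B y -> exists! x, rel f x y).

(* [n] is a von Neumann natural number. *)
Definition has_card (A : M -> Prop) (n : M) := exists f, bij f (elts n) A.

Definition finite (A : M -> Prop) := exists n, omega n /\ has_card A n.

Definition strict_total_order (r : M) (A : M -> Prop) :=
  sub_class (elts r) (prod_class A A) /\
  (forall x, ~ rel r x x) /\
  (forall x y z, rel r x y -> rel r y z -> rel r x z) /\
  (forall x y, A x -> A y -> rel r x y \/ x = y \/ rel r y x).

Definition equivalence_on (r : M) (A : M -> Prop) :=
  sub_class (elts r) (prod_class A A) /\
  (forall x, A x -> rel r x x) /\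
  (forall x y, rel r x y -> rel r y x) /\
  (forall x y z, rel r x y -> rel r y z -> rel r x z).

(** ZF, DC and the Baire property *)

Record ZF : Prop := {
  zf_extensionality : forall a b, (forall x, x in_ a <-> x in_ b) -> a = b;
  zf_foundation :
    forall a, ~ is_empty a -> exists x, x in_ a /\ ~ exists y, y in_ x /\ y in_ a;
  zf_pairing : forall x y, exists p, upair p x y;
  zf_union :
    forall a, exists u, is_set_of (fun x => exists b, b in_ a /\ x in_ b) u;
  zf_power :
    forall a, exists p, is_set_of (fun x => sub_class (elts x) (elts a)) p;
  zf_infinity :
    exists a, (exists e, is_empty e /\ e in_ a) /\
      (forall n, n in_ a -> exists s, is_succ s n /\ s in_ a);
  zf_separation :
    forall (phi : formula) (env : nat -> M) (a : M), exists b,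
      is_set_of (fun x => x in_ a /\ sat E (scons x env) phi) b;
  zf_replacement :
    forall (phi : formula) (env : nat -> M) (a : M),
      (forall x, x in_ a -> exists! y, sat E (scons y (scons x env)) phi) ->
      exists b, is_set_of
        (fun y => exists x, x in_ a /\ sat E (scons y (scons x env)) phi) b
}.

Definition DC :=
  forall X R, (exists x, x in_ X) ->
    (forall x, x in_ X -> exists y, y in_ X /\ rel R x y) ->
    exists z, func z omega (elts X) /\
      (forall n s x y, omega n -> is_succ s n -> rel z n x -> rel z s y ->
        rel R x y).

(* [{0, 1}], as the von Neumann numeral 2 *)
Definition two (e : M) := is_empty e \/ is_set_of is_empty e.

Definition cantor (x : M) := func x omega two.

(* Membership in a basic open neighbourhood of [x] for the product topology,
   the one given by a finite set [c] of coordinates. *)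
Definition agree_on (c x y : M) :=
  forall n e, n in_ c -> (rel x n e <-> rel y n e).

Definition cantor_open (U : M) :=
  sub_class (elts U) cantor /\
  (forall x, x in_ U -> exists c,
    sub_class (elts c) omega /\ finite (elts c) /\
    (forall y, cantor y -> agree_on c x y -> y in_ U)).

Definition cantor_closure (A x : M) :=
  cantor x /\
  (forall U, cantor_open U -> x in_ U -> exists y, y in_ U /\ y in_ A).

Definition nowhere_dense (A : M) :=
  sub_class (elts A) cantor /\
  (forall U, cantor_open U -> sub_class (elts U) (cantor_closure A) ->
    is_empty U).

Definition meager (A : M) :=
  exists F, func F omega nowhere_dense /\
    (forall x, x in_ A <-> exists n N, rel F n N /\ x in_ N).

Definition baire_property (Y : M) :=
  exists U D, cantor_open U /\
    is_set_of (fun x => (x in_ Y /\ ~ x in_ U) \/ (x in_ U /\ ~ x in_ Y)) D /\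
    meager D.

Definition all_baire_property :=
  forall Y, sub_class (elts Y) cantor -> baire_property Y.

Definition ZF_DC_BP := ZF /\ DC /\ all_baire_property.

(** Words *)

(* [a_n] is the pair [(n, 0)] and its formal inverse is [(n, 1)]. *)
Definition letter (l : M) := prod_class omega two l.

Definition letter_index (l n : M) := exists e, two e /\ opair l n e.

Definition inverse_letters (l l' : M) :=
  exists n e e', two e /\ two e' /\ e <> e' /\ opair l n e /\ opair l' n e'.

(* A word is coded by [(r, f)] with [f : D -> letters] and [r] the strict order
   of [D].  Words only matter up to [word_equiv], and every countable total
   order is isomorphic to one on a subset of omega, so [D] is taken to be such
   a subset; this makes the words a set rather than a proper class. *)
Definition wval (w i l : M) := exists r f, opair w r f /\ rel f i l.

Definition wdom (w i : M) := exists l, wval w i l.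

Definition wlt (w i j : M) := exists r f, opair w r f /\ rel r i j.

Definition occurs (w n i : M) := exists l, wval w i l /\ letter_index l n.

Definition word (w : M) :=
  exists r f d, opair w r f /\ sub_class (elts d) omega /\
    func f (elts d) letter /\ strict_total_order r (elts d) /\
    (forall n, omega n -> finite (occurs w n)).

Definition word_equiv (u v : M) :=
  exists f, bij f (wdom u) (wdom v) /\
    (forall i j i' j', rel f i i' -> rel f j j' ->
      (wlt u i j <-> wlt v i' j')) /\
    (forall i i' l, rel f i i' -> (wval u i l <-> wval v i' l)).

(* [v] is the restriction of [w] to the positions in [P]. *)
Definition restriction (w : M) (P : M -> Prop) (v : M) :=
  word v /\
  (forall i l, wval v i l <-> wval w i l /\ P i) /\
  (forall i j, wlt v i j <-> wlt w i j /\ P i /\ P j).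

(* [w] is, up to [word_equiv], the concatenation [u v]. *)
Definition concat (u v w : M) :=
  word w /\
  exists s u' v',
    (forall i j, wdom w i -> wdom w j -> i in_ s -> ~ j in_ s -> wlt w i j) /\
    restriction w (elts s) u' /\
    restriction w (fun i => ~ i in_ s) v' /\
    word_equiv u u' /\ word_equiv v v'.

Definition empty_word (w : M) := word w /\ forall i, ~ wdom w i.

Definition p_ (N w v : M) :=
  restriction w (fun i => exists n, occurs w n i /\ (n in_ N \/ n = N)) v.

(* Finite words in the letters of index at most [N] *)
Definition fin_word (N w : M) :=
  word w /\ finite (wdom w) /\
  (forall n i, occurs w n i -> n in_ N \/ n = N).

(* [v] is [u] with two consecutive, mutually inverse letters deleted. *)
Definition cancels (u v : M) :=
  exists i j l l',
    wlt u i j /\ (~ exists k, wlt u i k /\ wlt u k j) /\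
    wval u i l /\ wval u j l' /\ inverse_letters l l' /\
    restriction u (fun k => k <> i /\ k <> j) v.

(* Equality in the free group on [a_0, ..., a_N]: the equivalence relation on
   finite words generated by free cancellation. *)
Definition free_eq (N u v : M) :=
  forall R, equivalence_on R (fin_word N) ->
    (forall x y, fin_word N x -> fin_word N y -> word_equiv x y -> rel R x y) ->
    (forall x y, fin_word N x -> fin_word N y -> cancels x y -> rel R x y) ->
    rel R u v.

Definition word_sim (u v : M) :=
  forall N, omega N ->
    exists u' v', p_ N u u' /\ p_ N v v' /\ free_eq N u' v'.

(** The Hawaiian earring group and its subgroups *)

(* The elements of HEG, as sets of words *)
Definition HEG (h : M) :=
  exists w, word w /\ is_set_of (fun v => word v /\ word_sim v w) h.

Definition HEG_mul (x y z : M) :=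
  HEG x /\ HEG y /\ HEG z /\
  exists u v w, u in_ x /\ v in_ y /\ w in_ z /\ concat u v w.

Definition reduced (w : M) :=
  word w /\
  forall u v x uv, word u -> word v -> word x ->
    concat u v uv -> concat uv x w ->
    forall e, empty_word e -> word_sim v e -> word_equiv v e.

Definition uniformly_bounded (w : M) :=
  exists N, omega N /\
    forall n, omega n -> exists k, k in_ N /\ has_card (occurs w n) k.

Definition densely_ordered (w s : M) :=
  forall i j, i in_ s -> j in_ s -> wlt w i j ->
    exists k, k in_ s /\ wlt w i k /\ wlt w k j.

Definition scattered (w : M) :=
  forall s, sub_class (elts s) (wdom w) -> densely_ordered w s ->
    forall i j, i in_ s -> j in_ s -> i = j.

Definition BD (h : M) :=
  HEG h /\ exists w, w in_ h /\ reduced w /\ uniformly_bounded w.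

Definition SCAT (h : M) :=
  HEG h /\ exists w, w in_ h /\ reduced w /\ scattered w.

(** Free groups *)

(* A binary operation is a set of pairs [((x, y), z)]. *)
Definition app2 (m x y z : M) := exists q, opair q x y /\ rel m q z.

Definition is_group (G m : M) :=
  func m (prod_class (elts G) (elts G)) (elts G) /\
  (forall x y z xy yz t, app2 m x y xy -> app2 m y z yz ->
    (app2 m xy z t <-> app2 m x yz t)) /\
  (exists e, e in_ G /\
    (forall x, x in_ G -> app2 m e x x /\ app2 m x e x) /\
    (forall x, x in_ G -> exists y, y in_ G /\ app2 m x y e /\ app2 m y x e)).

Definition group_hom (h G m H n : M) :=
  func h (elts G) (elts H) /\
  (forall x y z x' y' z', app2 m x y z ->
    rel h x x' -> rel h y y' -> rel h z z' -> app2 n x' y' z').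

Definition free_basis (X G m : M) :=
  sub_class (elts X) (elts G) /\
  forall H n, is_group H n -> forall f, func f (elts X) (elts H) ->
    exists! h, group_hom h G m H n /\ sub_class (elts f) (elts h).

Definition is_free_group (G m : M) :=
  is_group G m /\ exists X, free_basis X G m.

(* [(G, m)] is the set of all [h] in [P], a class of elements of HEG, with the
   multiplication of HEG restricted to it. *)
Definition is_HEG_part (P : M -> Prop) (G m : M) :=
  is_set_of P G /\
  is_set_of (fun p => exists q x y z, opair p q z /\ opair q x y /\
    P x /\ P y /\ HEG_mul x y z) m.

End InsideModel.

(* Main.v *)
Require Import Defs.
From Stdlib Require Import Classical ClassicalEpsilon FunctionalExtensionality
  PropExtensionality Arith Lia.

(** Write [W_A], for [A] a subset of omega, for the product of the letters [a_n]
    with [n] in [A], in increasing order; it is reduced, has a scattered domain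
    and uses each letter at most once, so its class lies in BD and in SCAT.
    Suppose that one of these groups, [G], is free on [X].  The countably many
    elements [a_n] lie in the subgroup [K] generated by a countable subset [Y]
    of [X], and the retraction of [G] onto [K] that kills [X] minus [Y] fixes
    every [a_n].  Colour a point of Cantor space, read as a set [A], by the image
    of [W_A] in the countable group [K].  Adding [n] to [A] inserts the letter
    [a_n] in [W_A], so it changes the colour, because [a_n] is not trivial.  By
    the Baire property a set that never contains two points differing in
    exactly one coordinate is meager; hence Cantor space would be a countable
    union of meager sets.

    All of this takes place inside the model [(M, E)].  Separation is only
    available for classes given by formulas, so each class that is used must be
    shown to be definable; the tactic [dfn] does this by recursion on the
    syntax of the class. *)

Set Implicit Arguments.
Unset Strict Implicit.

(** * Definable classes *)

Section Definability.

Context (M : Type) (E : M -> M -> Prop).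

(** Freeness is used only through two consequences of the universal property: the basis generates
    the group, and a map on the basis extends; there are no normal forms. Words are not reduced by
    hand either. The parity of the number of occurrences of [a_n] is invariant under [word_sim], and
    this one invariant shows both that [a_n] is nontrivial and that every [W_A] is reduced. Letters
    increase along [W_A] so that inserting [n] turns a product of two such words into the same
    product with [a_n] in the middle; cancellation in the group then isolates [a_n]. The ambient
    epsilon operator could smuggle choice into the model. It serves only for definite descriptions,
    and every choice inside the model goes through DC. DC makes genuine choices (enumerations,
    supports, witnesses of meagerness) and also acts as a recursion principle, by iterating a
    functional relation. Since the chosen witnesses must range over a set, enumerations and meager
    covers are kept as elements of explicit power sets. *)

Definition up (r : nat -> nat) (n : nat) : nat :=
  match n with O => O | S k => S (r k) end.

Fixpoint ren (r : nat -> nat) (p : formula) : formula :=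
  match p with
  | FMem i j => FMem (r i) (r j)
  | FEq i j => FEq (r i) (r j)
  | FNot p => FNot (ren r p)
  | FAnd p q => FAnd (ren r p) (ren r q)
  | FOr p q => FOr (ren r p) (ren r q)
  | FImp p q => FImp (ren r p) (ren r q)
  | FAll p => FAll (ren (up r) p)
  | FEx p => FEx (ren (up r) p)
  end.

Lemma scons_up (x : M) (env : nat -> M) (r : nat -> nat) :
  (fun i => scons x env (up r i)) = scons x (fun i => env (r i)).
Proof. apply functional_extensionality; intros [|i]; reflexivity. Qed.

Lemma sat_ren (p : formula) : forall (r : nat -> nat) (env : nat -> M),
  sat E env (ren r p) <-> sat E (fun i => env (r i)) p.
Proof.
  induction p; intros r env; simpl;
    try (rewrite ?IHp, ?IHp1, ?IHp2; reflexivity).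
  - split; intros H x; specialize (H x); rewrite IHp, scons_up in *; exact H.
  - split; intros [x H]; exists x; rewrite IHp, scons_up in *; exact H.
Qed.

(* [v] gives the values of the first [n] variables; the others are
   parameters. *)
Definition mix (n : nat) (v rho : nat -> M) (i : nat) : M :=
  if i <? n then v i else rho (i - n).

(** The equivalence holds for every [v], so [P] can depend only on the first [n] values of [v]. The
    parameters [rho] match those allowed in the Separation scheme. *)
Definition definable (n : nat) (P : (nat -> M) -> Prop) : Prop :=
  exists phi rho, forall v, P v <-> sat E (mix n v rho) phi.

(** A term is an ambient function, and it counts as definable when its graph is; the value sits at
    index 0 and the arguments are shifted by one. *)
Definition definableT (n : nat) (t : (nat -> M) -> M) : Prop :=
  definable (S n) (fun v => v 0 = t (fun i => v (S i))).

Lemma definable_ext n (P Q : (nat -> M) -> Prop) :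
  (forall v, P v <-> Q v) -> definable n P -> definable n Q.
Proof.
  intros H (phi & rho & HP); exists phi, rho; intros v; rewrite <- H; apply HP.
Qed.

Lemma definable_ren n m (s : nat -> nat) P :
  (forall i, i < n -> s i < m) -> definable n P ->
  definable m (fun v => P (fun i => v (s i))).
Proof.
  intros Hs (phi & rho & HP).
  (* Parameter number [k] moves from index [n + k] to index [m + k], so the same [rho] serves. *)
  exists (ren (fun i => if i <? n then s i else m + (i - n)) phi), rho.
  intros v; rewrite HP, sat_ren.
  match goal with |- sat _ ?a _ <-> sat _ ?b _ => replace a with b; [reflexivity|] end.
  apply functional_extensionality; intros i; unfold mix.
  destruct (i <? n) eqn:Hi.
  - apply Nat.ltb_lt in Hi. specialize (Hs _ Hi).
    apply Nat.ltb_lt in Hs; rewrite Hs; reflexivity.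
  - replace (m + (i - n) <? m) with false by (symmetry; apply Nat.ltb_ge; lia).
    f_equal; lia.
Qed.

(* Two formulas are given common parameters by interleaving. *)
Lemma definable_bin n P Q : definable n P -> definable n Q ->
  exists phi psi rho, (forall v, P v <-> sat E (mix n v rho) phi) /\
    (forall v, Q v <-> sat E (mix n v rho) psi).
Proof.
  intros (phi & rho & HP) (psi & sig & HQ).
  exists (ren (fun i => if i <? n then i else n + 2 * (i - n)) phi),
    (ren (fun i => if i <? n then i else S (n + 2 * (i - n))) psi),
    (fun i => if Nat.even i then rho (Nat.div2 i) else sig (Nat.div2 i)).
  split; intros v; [rewrite HP|rewrite HQ]; rewrite sat_ren;
  match goal with |- sat _ ?a _ <-> sat _ ?b _ => replace a with b; [reflexivity|] end;
  apply functional_extensionality; intros i; unfold mix;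
  destruct (i <? n) eqn:Hi; rewrite ?Hi; try reflexivity.
  - replace (n + 2 * (i - n) <? n) with false by (symmetry; apply Nat.ltb_ge; lia).
    replace (n + 2 * (i - n) - n) with (2 * (i - n)) by lia.
    rewrite Nat.even_mul, Nat.div2_double; reflexivity.
  - replace (S (n + 2 * (i - n)) <? n) with false by (symmetry; apply Nat.ltb_ge; lia).
    replace (S (n + 2 * (i - n)) - n) with (S (2 * (i - n))) by lia.
    rewrite Nat.even_succ, <- Nat.negb_even, Nat.even_mul, Nat.div2_succ_double.
    reflexivity.
Qed.

Lemma def_and n P Q : definable n P -> definable n Q ->
  definable n (fun v => P v /\ Q v).
Proof.
  intros HP HQ; destruct (definable_bin HP HQ) as (phi & psi & rho & H1 & H2).
  exists (FAnd phi psi), rho; intros v; simpl; rewrite H1, H2; reflexivity.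
Qed.

Lemma def_or n P Q : definable n P -> definable n Q ->
  definable n (fun v => P v \/ Q v).
Proof.
  intros HP HQ; destruct (definable_bin HP HQ) as (phi & psi & rho & H1 & H2).
  exists (FOr phi psi), rho; intros v; simpl; rewrite H1, H2; reflexivity.
Qed.

Lemma def_imp n (P Q : (nat -> M) -> Prop) : definable n P -> definable n Q ->
  definable n (fun v => P v -> Q v).
Proof.
  intros HP HQ; destruct (definable_bin HP HQ) as (phi & psi & rho & H1 & H2).
  exists (FImp phi psi), rho; intros v; simpl; rewrite H1, H2; reflexivity.
Qed.

Lemma def_not n P : definable n P -> definable n (fun v => ~ P v).
Proof.
  intros (phi & rho & HP); exists (FNot phi), rho; intros v; simpl.
  rewrite HP; reflexivity.
Qed.

Lemma def_iff n P Q : definable n P -> definable n Q ->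
  definable n (fun v => P v <-> Q v).
Proof. intros HP HQ; unfold iff; apply def_and; apply def_imp; assumption. Qed.

Lemma mix_scons n x v rho : mix (S n) (scons x v) rho = scons x (mix n v rho).
Proof. apply functional_extensionality; intros [|i]; reflexivity. Qed.

(** Separating the bound variable from the environment lets unification read [Q] off a quantified
    goal; under the quantifier the other variables are shifted by one. *)
Lemma def_all n (Q : M -> (nat -> M) -> Prop) :
  definable (S n) (fun v => Q (v 0) (fun i => v (S i))) ->
  definable n (fun v => forall x, Q x v).
Proof.
  intros (phi & rho & HP); exists (FAll phi), rho; intros v; simpl.
  split; intros H x; specialize (H x).
  - rewrite <- mix_scons; apply (HP (scons x v)); exact H.
  - rewrite <- mix_scons in H; apply (HP (scons x v)) in H; exact H.
Qed.

Lemma def_ex n (Q : M -> (nat -> M) -> Prop) :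
  definable (S n) (fun v => Q (v 0) (fun i => v (S i))) ->
  definable n (fun v => exists x, Q x v).
Proof.
  intros (phi & rho & HP); exists (FEx phi), rho; intros v; simpl.
  split; intros [x H]; exists x.
  - rewrite <- mix_scons; apply (HP (scons x v)); exact H.
  - rewrite <- mix_scons in H; apply (HP (scons x v)) in H; exact H.
Qed.

(** Equality of two variables is a premise, discharged once [M] is known to be inhabited: an atomic
    formula still needs some parameter environment. *)
Lemma def_exuniq n (Q : M -> (nat -> M) -> Prop) :
  definable (S n) (fun v => Q (v 0) (fun i => v (S i))) ->
  definable (S (S n)) (fun v => Q (v 0) (fun i => v (S (S i)))) ->
  definable (S (S n)) (fun v => v 1 = v 0) ->
  definable n (fun v => exists! x, Q x v).
Proof.
  intros H1 H2 H3; unfold unique.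
  apply def_ex with (Q := fun x v => Q x v /\ forall y, Q y v -> x = y).
  apply def_and; [exact H1|].
  apply def_all with (Q := fun y v => Q y (fun i => v (S i)) -> v 0 = y).
  apply def_imp; assumption.
Qed.

(** Weakening under a binder: the value stays at index 0 and a fresh variable enters at index 1. *)
Lemma definable_shift n t : definableT n t ->
  definableT (S n) (fun v => t (fun i => v (S i))).
Proof.
  intros H.
  apply (definable_ren (m := S (S n))
    (s := fun i => match i with 0 => 0 | S i => S (S i) end)) in H.
  - exact H.
  - intros [|i]; lia.
Qed.

Lemma definable_mid n (P : M -> (nat -> M) -> Prop) :
  definable (S n) (fun v => P (v 0) (fun i => v (S i))) ->
  definable (S (S n)) (fun v => P (v 0) (fun i => v (S (S i)))).
Proof.
  intros H.
  apply (definable_ren (m := S (S n))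
    (s := fun i => match i with 0 => 0 | S i => S (S i) end)) in H.
  - exact H.
  - intros [|i]; lia.
Qed.

Lemma defT_const n a : definableT n (fun _ => a).
Proof. exists (FEq 0 (S n)), (fun _ => a); intros v; simpl; unfold mix; simpl.
  rewrite Nat.ltb_irrefl; reflexivity.
Qed.

End Definability.

(* These are notations, not definitions, so that proof search sees the products. *)
Notation Def1 E P :=
  (forall n f, definableT E n f -> definable E n (fun v => P (f v))).

Notation Def2 E P :=
  (forall n f g, definableT E n f -> definableT E n g ->
    definable E n (fun v => P (f v) (g v))).

Notation Def3 E P :=
  (forall n f g h, definableT E n f -> definableT E n g -> definableT E n h ->
    definable E n (fun v => P (f v) (g v) (h v))).

Notation DefF1 E F :=
  (forall n f, definableT E n f -> definableT E n (fun v => F (f v))).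

Notation DefF2 E F :=
  (forall n f g, definableT E n f -> definableT E n g ->
    definableT E n (fun v => F (f v) (g v))).

(** * Definable terms, definite descriptions and Separation *)

Section Separation.

Context (M : Type) (E : M -> M -> Prop) (zf : ZF E).

Lemma zf_inhabited : inhabited M.
Proof. destruct (zf_infinity zf) as [a _]; exact (inhabits a). Qed.

Lemma def_atoms n (i j : nat) : i < n -> j < n ->
  definable E n (fun v => E (v i) (v j)) /\ definable E n (fun v => v i = v j).
Proof.
  intros Hi Hj; apply Nat.ltb_lt in Hi, Hj.
  destruct zf_inhabited as [a]; split.
  - exists (FMem i j), (fun _ => a); intros v; simpl; unfold mix.
    rewrite Hi, Hj; reflexivity.
  - exists (FEq i j), (fun _ => a); intros v; simpl; unfold mix.
    rewrite Hi, Hj; reflexivity.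
Qed.

Lemma defT_var n k : k < n -> definableT E n (fun v => v k).
Proof. intros Hk; apply (@def_atoms (S n) 0 (S k)); lia. Qed.

(** The formula language has no terms, so an atom containing terms is unfolded into existential
    quantifiers over their graphs. *)
Lemma def_term2 n (R : M -> M -> Prop) f g :
  definable E (S (S n)) (fun v => R (v 1) (v 0)) ->
  definableT E n f -> definableT E n g -> definable E n (fun v => R (f v) (g v)).
Proof.
  intros HR Hf Hg.
  apply definable_ext with
    (P := fun v => exists x, x = f v /\ exists y, y = g v /\ R x y).
  - intros v; split.
    + intros (x & -> & y & -> & H); exact H.
    + intros H; exists (f v); split; [reflexivity|]; exists (g v); auto.
  - apply def_ex with (Q := fun x v => x = f v /\ exists y, y = g v /\ R x y).
    apply def_and; [exact Hf|].
    apply def_ex with (Q := fun y v => y = g (fun i => v (S i)) /\ R (v 0) y).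
    apply def_and; [|exact HR].
    exact (definable_shift Hg).
Qed.

Lemma def_mem : Def2 E E.
Proof. intros n f g; apply def_term2; apply (@def_atoms (S (S n)) 1 0); lia. Qed.

Lemma def_eq : Def2 E (@eq M).
Proof. intros n f g; apply def_term2; apply (@def_atoms (S (S n)) 1 0); lia. Qed.

Lemma def_uniq n (Q : M -> (nat -> M) -> Prop) :
  definable E (S n) (fun v => Q (v 0) (fun i => v (S i))) ->
  definable E n (fun v => exists! x, Q x v).
Proof.
  intros H; apply def_exuniq; [exact H|exact (definable_mid H)|].
  apply (@def_atoms (S (S n)) 1 0); lia.
Qed.

Lemma Def1_sat (P : M -> Prop) : Def1 E P ->
  exists phi rho, forall x, P x <-> sat E (scons x rho) phi.
Proof.
  intros H; destruct (H 1 (fun v => v 0) (defT_var (n := 1) (k := 0) ltac:(lia)))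
    as (phi & rho & HP).
  exists phi, rho; intros x; rewrite (HP (fun _ => x)).
  match goal with |- sat _ ?a _ <-> sat _ ?b _ => replace a with b; [reflexivity|] end.
  apply functional_extensionality; intros [|i]; unfold mix; simpl;
    [reflexivity|f_equal; lia].
Qed.

(** Epsilon is applied to [unique P], so it selects nothing that [P] does not already determine,
    except one junk value. *)
Definition iota (P : M -> Prop) : M := epsilon zf_inhabited (unique P).

Lemma iotaP (P : M -> Prop) : (exists! x, P x) -> P (iota P).
Proof. intros H; exact (proj1 (epsilon_spec zf_inhabited _ H)). Qed.

Lemma iota_eq (P : M -> Prop) x : unique P x -> iota P = x.
Proof.
  intros H; symmetry; apply (proj2 H); apply iotaP; exists x; exact H.
Qed.

(** Without a unique solution [unique P] is the everywhere false predicate, and epsilon gives the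
    same value for all such [P]. This uniformity makes descriptions definable. *)
Lemma iota_junk (P : M -> Prop) : ~ (exists! x, P x) -> iota P = iota (fun _ => False).
Proof.
  intros H; unfold iota; f_equal; apply functional_extensionality; intros x.
  apply propositional_extensionality; split.
  - intros Hx; destruct H; exists x; exact Hx.
  - intros [[] _].
Qed.

(** The graph is a disjunction: the value is the unique solution, or there is none and the value is
    the junk element, which enters as a parameter. *)
Lemma defT_iota n (P : (nat -> M) -> M -> Prop) :
  definable E (S n) (fun v => P (fun i => v (S i)) (v 0)) ->
  definableT E n (fun v => iota (P v)).
Proof.
  intros HP.
  pose (P' := fun x v => P v x).
  assert (HP1 : definable E (S (S n)) (fun v => P' (v 0) (fun i => v (S (S i)))))
    by exact (definable_mid (P := P') HP).
  apply definable_ext with (P := fun v =>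
    (P (fun i => v (S i)) (v 0) /\ forall y, P (fun i => v (S i)) y -> v 0 = y) \/
    (~ (exists! y, P' y (fun i => v (S i))) /\ v 0 = iota (fun _ => False))).
  - intros v; split.
    + intros [H | [H ->]]; symmetry; [exact (iota_eq H)|exact (iota_junk H)].
    + intros H; destruct (classic (exists! y, P (fun i => v (S i)) y)) as [[y Hy]|Hn].
      * left; rewrite H, (iota_eq (Hy : unique (P (fun i => v (S i))) y)); exact Hy.
      * right; split; [exact Hn|]; rewrite H; exact (iota_junk Hn).
  - apply def_or; apply def_and.
    + exact HP.
    + apply def_all with (Q := fun y v => P' y (fun i => v (S i)) -> v 0 = y).
      apply def_imp; [exact HP1|].
      apply def_eq; apply defT_var; lia.
    + apply def_not, def_uniq with (Q := fun y v => P' y (fun i => v (S i))).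
      exact HP1.
    + apply def_eq; [apply defT_var; lia|apply defT_const].
Qed.

(** Any ambient predicate is accepted, but the set is only guaranteed to exist when [P] is
    definable; [sepP] carries that condition. *)
Definition sep (a : M) (P : M -> Prop) : M :=
  iota (fun b => forall x, E x b <-> E x a /\ P x).

Lemma ext (a b : M) : (forall x, E x a <-> E x b) -> a = b.
Proof. apply (zf_extensionality zf). Qed.

Lemma sepP (a : M) (P : M -> Prop) : Def1 E P ->
  forall x, E x (sep a P) <-> E x a /\ P x.
Proof.
  intros H; destruct (Def1_sat H) as (phi & rho & HP).
  unfold sep; apply iotaP.
  destruct (zf_separation zf phi rho a) as [b Hb]; exists b.
  assert (Hb' : forall x, E x b <-> E x a /\ P x)
    by (intros x; rewrite (Hb x), HP; reflexivity).
  split; [exact Hb'|].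
  intros c Hc; apply ext; intros x; rewrite Hb', Hc; reflexivity.
Qed.

Lemma defT_sep n t (P : (nat -> M) -> M -> Prop) :
  definableT E n t -> definable E (S n) (fun v => P (fun i => v (S i)) (v 0)) ->
  definableT E n (fun v => sep (t v) (P v)).
Proof.
  intros Ht HP; unfold sep.
  apply defT_iota with (P := fun v b => forall x, E x b <-> E x (t v) /\ P v x).
  apply def_all with (Q := fun x v => E x (v 0) <->
      E x (t (fun i => v (S i))) /\ P (fun i => v (S i)) x).
  apply def_iff; [|apply def_and].
  - apply def_mem; apply defT_var; lia.
  - apply def_mem; [apply defT_var; lia|].
    exact (definable_shift (definable_shift Ht)).
  - exact (definable_mid (P := fun x v => P v x) HP).
Qed.

End Separation.

(* Proof search for definability *)
Create HintDb dfn.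
#[export] Hint Constants Opaque : dfn.
#[export] Hint Extern 0 (definable _ _ _) => progress cbv beta : dfn.
#[export] Hint Extern 0 (definableT _ _ _) => progress cbv beta : dfn.
#[export] Hint Resolve def_and def_or def_imp def_not def_iff def_all def_ex
  def_uniq def_mem def_eq defT_const defT_sep defT_iota : dfn.
#[export] Hint Extern 1 (definableT _ _ (fun v => v _)) =>
  simple eapply defT_var; [eassumption | lia] : dfn.

#[export] Hint Extern 1 (definableT _ (S _) (fun v => ?g (fun i => v (S (@?k i))))) =>
  simple refine (@definable_shift _ _ _ (fun v => g (fun i => v (k i))) _) : dfn.

(** Constants are opaque to the search, so each notion is recognised by its own lemma. The notions
    that take or return classes are unfolded beforehand, because a class argument is not a term
    whose graph could be definable. *)
Ltac dfn :=
  intros;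
  cbv beta delta [func bij has_card finite sub_class is_set_of prod_class elts
    strict_total_order equivalence_on restriction app2];
  typeclasses eauto with dfn nocore.

(** * Definability of the notions of the statement *)

Section DefinableNotions.

Context (M : Type) (E : M -> M -> Prop) (zf : ZF E).

Lemma def_is_empty : Def1 E (is_empty E).
Proof. unfold is_empty; dfn. Qed.
Lemma def_is_succ : Def2 E (is_succ E).
Proof. unfold is_succ; dfn. Qed.
#[local] Hint Resolve def_is_empty def_is_succ : dfn.
Lemma def_omega : Def1 E (omega E).
Proof. unfold omega, inductive_set; dfn. Qed.
Lemma def_opair : Def3 E (opair E).
Proof. unfold opair, upair; dfn. Qed.
#[local] Hint Resolve def_omega def_opair : dfn.
Lemma def_rel : Def3 E (rel E).
Proof. unfold rel; dfn. Qed.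
Lemma def_two : Def1 E (two E).
Proof. unfold two; dfn. Qed.
#[local] Hint Resolve def_rel def_two : dfn.
Lemma def_cantor : Def1 E (cantor E).
Proof. unfold cantor; dfn. Qed.
Lemma def_agree_on : Def3 E (agree_on E).
Proof. unfold agree_on; dfn. Qed.
#[local] Hint Resolve def_cantor def_agree_on : dfn.
Lemma def_cantor_open : Def1 E (cantor_open E).
Proof. unfold cantor_open; dfn. Qed.
#[local] Hint Resolve def_cantor_open : dfn.
Lemma def_nowhere_dense : Def1 E (nowhere_dense E).
Proof. unfold nowhere_dense, cantor_closure; dfn. Qed.

Lemma def_letter : Def1 E (letter E).
Proof. unfold letter; dfn. Qed.
Lemma def_letter_index : Def2 E (letter_index E).
Proof. unfold letter_index; dfn. Qed.
Lemma def_inverse_letters : Def2 E (inverse_letters E).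
Proof. unfold inverse_letters; dfn. Qed.
Lemma def_wval : Def3 E (wval E).
Proof. unfold wval; dfn. Qed.
#[local] Hint Resolve def_nowhere_dense def_letter def_letter_index
  def_inverse_letters def_wval : dfn.
Lemma def_wdom : Def2 E (wdom E).
Proof. unfold wdom; dfn. Qed.
Lemma def_wlt : Def3 E (wlt E).
Proof. unfold wlt; dfn. Qed.
Lemma def_occurs : Def3 E (occurs E).
Proof. unfold occurs; dfn. Qed.
#[local] Hint Resolve def_wdom def_wlt def_occurs : dfn.
Lemma def_word : Def1 E (word E).
Proof. unfold word; dfn. Qed.
Lemma def_word_equiv : Def2 E (word_equiv E).
Proof. unfold word_equiv; dfn. Qed.
#[local] Hint Resolve def_word def_word_equiv : dfn.
Lemma def_concat : Def3 E (concat E).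
Proof. unfold concat; dfn. Qed.
Lemma def_empty_word : Def1 E (empty_word E).
Proof. unfold empty_word; dfn. Qed.
Lemma def_p_ : Def3 E (p_ E).
Proof. unfold p_; dfn. Qed.
Lemma def_fin_word : Def2 E (fin_word E).
Proof. unfold fin_word; dfn. Qed.
Lemma def_cancels : Def2 E (cancels E).
Proof. unfold cancels; dfn. Qed.
#[local] Hint Resolve def_concat def_empty_word def_p_ def_fin_word
  def_cancels : dfn.
Lemma def_free_eq : Def3 E (free_eq E).
Proof. unfold free_eq; dfn. Qed.
#[local] Hint Resolve def_free_eq : dfn.
Lemma def_word_sim : Def2 E (word_sim E).
Proof. unfold word_sim; dfn. Qed.
#[local] Hint Resolve def_word_sim : dfn.
Lemma def_HEG : Def1 E (HEG E).
Proof. unfold HEG; dfn. Qed.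
Lemma def_reduced : Def1 E (reduced E).
Proof. unfold reduced; dfn. Qed.
Lemma def_uniformly_bounded : Def1 E (uniformly_bounded E).
Proof. unfold uniformly_bounded; dfn. Qed.
Lemma def_scattered : Def1 E (scattered E).
Proof. unfold scattered, densely_ordered; dfn. Qed.
#[local] Hint Resolve def_HEG def_reduced def_uniformly_bounded def_scattered : dfn.
Lemma def_HEG_mul : Def3 E (HEG_mul E).
Proof. unfold HEG_mul; dfn. Qed.
Lemma def_BD : Def1 E (BD E).
Proof. unfold BD; dfn. Qed.
Lemma def_SCAT : Def1 E (SCAT E).
Proof. unfold SCAT; dfn. Qed.

End DefinableNotions.

#[export] Hint Resolve def_is_empty def_is_succ def_omega def_opair def_rel
  def_two def_cantor def_agree_on def_cantor_open def_nowhere_dense def_letter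
  def_letter_index def_inverse_letters def_wval def_wdom def_wlt def_occurs
  def_word def_word_equiv def_concat def_empty_word def_p_ def_fin_word
  def_cancels def_free_eq def_word_sim def_HEG def_reduced
  def_uniformly_bounded def_scattered def_HEG_mul def_BD def_SCAT : dfn.

(** * Sets, functions and natural numbers *)

Section Constructions.

Context (M : Type) (E : M -> M -> Prop) (zf : ZF E).

Definition upr (x y : M) : M := iota zf (fun p => upair E p x y).
Definition pair (x y : M) : M := iota zf (fun p => opair E p x y).
Definition union (a : M) : M :=
  iota zf (fun u => forall x, E x u <-> exists b, E b a /\ E x b).
Definition pow (a : M) : M :=
  iota zf (fun u => forall x, E x u <-> forall z, E z x -> E z a).
Definition emp : M := iota zf (is_empty E).
Definition om : M := iota zf (fun o => forall n, E n o <-> omega E n).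
Definition sing (x : M) : M := upr x x.
Definition cup (a b : M) : M := union (upr a b).
Definition succ (n : M) : M := cup n (sing n).
(** A Kuratowski pair of elements of [a] and [b] is a set of subsets of [cup a b], whence the double
    power set. *)
Definition prod (a b : M) : M :=
  sep zf (pow (pow (cup a b))) (prod_class E (elts E a) (elts E b)).
Definition fapp (f x : M) : M := iota zf (rel E f x).

Lemma iota_set (P : M -> Prop) : (exists a, forall x, E x a <-> P x) ->
  forall x, E x (iota zf (fun a => forall x, E x a <-> P x)) <-> P x.
Proof.
  intros [a Ha].
  apply (iotaP zf (P := fun a => forall x, E x a <-> P x)).
  exists a; split; [exact Ha|]; intros b Hb; apply (ext zf); intros x.
  rewrite Ha, Hb; reflexivity.
Qed.

Lemma uprP x y t : E t (upr x y) <-> t = x \/ t = y.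
Proof. apply iota_set; exact (zf_pairing zf x y). Qed.

Lemma singP x t : E t (sing x) <-> t = x.
Proof. unfold sing; rewrite uprP; tauto. Qed.

Lemma unionP a x : E x (union a) <-> exists b, E b a /\ E x b.
Proof. apply iota_set; exact (zf_union zf a). Qed.

Lemma powP a x : E x (pow a) <-> forall z, E z x -> E z a.
Proof. apply iota_set; exact (zf_power zf a). Qed.

Lemma cupP a b x : E x (cup a b) <-> E x a \/ E x b.
Proof.
  unfold cup; rewrite unionP; split.
  - intros (c & Hc & Hx); apply uprP in Hc; destruct Hc as [->| ->]; auto.
  - intros [H|H]; [exists a|exists b]; rewrite uprP; auto.
Qed.

Lemma succP n x : E x (succ n) <-> E x n \/ x = n.
Proof. unfold succ; rewrite cupP, singP; reflexivity. Qed.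

Lemma upair_upr p x y : upair E p x y <-> p = upr x y.
Proof.
  split.
  - intros H; apply (ext zf); intros t; rewrite (H t), uprP; reflexivity.
  - intros -> t; apply uprP.
Qed.

Lemma upr_eq a b c d : upr a b = upr c d ->
  (a = c /\ b = d) \/ (a = d /\ b = c).
Proof.
  intros H.
  assert (Ha : E a (upr c d)) by (rewrite <- H; apply uprP; auto).
  assert (Hb : E b (upr c d)) by (rewrite <- H; apply uprP; auto).
  assert (Hc : E c (upr a b)) by (rewrite H; apply uprP; auto).
  assert (Hd : E d (upr a b)) by (rewrite H; apply uprP; auto).
  rewrite uprP in Ha, Hb, Hc, Hd.
  destruct Ha, Hb, Hc, Hd; subst; auto.
Qed.

Lemma opair_upr p x y : opair E p x y <-> p = upr (sing x) (upr x y).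
Proof.
  unfold opair; split.
  - intros (a & b & Ha & Hb & Hp); rewrite upair_upr in Ha, Hb, Hp.
    subst; reflexivity.
  - intros ->; exists (sing x), (upr x y); rewrite !upair_upr; auto.
Qed.

Lemma opairP p x y : opair E p x y <-> p = pair x y.
Proof.
  assert (H : pair x y = upr (sing x) (upr x y)).
  { apply iota_eq; split; [apply opair_upr; reflexivity|].
    intros q Hq; apply opair_upr in Hq; auto. }
  rewrite H; apply opair_upr.
Qed.

Lemma pair_inj x y x' y' : pair x y = pair x' y' -> x = x' /\ y = y'.
Proof.
  intros H.
  assert (H' : forall a b, pair a b = upr (sing a) (upr a b))
    by (intros a b; apply opair_upr, opairP; reflexivity).
  rewrite !H' in H; clear H'.
  unfold sing in H; apply upr_eq in H.
  destruct H as [[H1 H2]|[H1 H2]]; apply upr_eq in H1, H2;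
    destruct H1 as [[]|[]], H2 as [[]|[]]; subst; auto.
Qed.

Lemma pair_eq x y x' y' : pair x y = pair x' y' <-> x = x' /\ y = y'.
Proof. split; [apply pair_inj|intros [-> ->]; reflexivity]. Qed.

Lemma relP r x y : rel E r x y <-> E (pair x y) r.
Proof.
  unfold rel; split.
  - intros (p & Hp & H); apply opairP in Hp; subst; exact H.
  - intros H; exists (pair x y); rewrite opairP; auto.
Qed.

Lemma DefF2_upr : DefF2 E upr.
Proof. unfold upr, upair; dfn. Qed.
Lemma DefF2_pair : DefF2 E pair.
Proof. unfold pair; dfn. Qed.
Lemma DefF1_union : DefF1 E union.
Proof. unfold union; dfn. Qed.
Lemma DefF1_pow : DefF1 E pow.
Proof. unfold pow; dfn. Qed.
#[local] Hint Resolve DefF2_upr DefF2_pair DefF1_union DefF1_pow : dfn.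
Lemma DefF1_sing : DefF1 E sing.
Proof. unfold sing; dfn. Qed.
Lemma DefF2_cup : DefF2 E cup.
Proof. unfold cup; dfn. Qed.
#[local] Hint Resolve DefF1_sing DefF2_cup : dfn.
Lemma DefF1_succ : DefF1 E succ.
Proof. unfold succ; dfn. Qed.
Lemma DefF2_prod : DefF2 E prod.
Proof. unfold prod; dfn. Qed.
Lemma DefF2_fapp : DefF2 E fapp.
Proof. unfold fapp; dfn. Qed.
#[local] Hint Resolve DefF1_succ DefF2_prod DefF2_fapp : dfn.

Lemma prodP a b p : E p (prod a b) <-> exists x y, E x a /\ E y b /\ p = pair x y.
Proof.
  unfold prod; rewrite (sepP zf) by dfn; unfold prod_class, elts; split.
  - intros (_ & x & y & Hx & Hy & Hp); apply opairP in Hp; eauto.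
  - intros (x & y & Hx & Hy & Hp); split; [|exists x, y; rewrite opairP; auto].
    apply opairP, opair_upr in Hp; subst p.
    apply powP; intros z Hz; apply powP; intros t Ht; apply cupP.
    apply uprP in Hz; destruct Hz as [-> | ->].
    + apply singP in Ht; subst; auto.
    + apply uprP in Ht; destruct Ht; subst; auto.
Qed.

Lemma in_prod a b x y : E (pair x y) (prod a b) <-> E x a /\ E y b.
Proof.
  rewrite prodP; split.
  - intros (u & w & Hu & Hw & H); apply pair_inj in H; destruct H; subst; auto.
  - intros []; exists x, y; auto.
Qed.

Lemma class_eq (P Q : M -> Prop) : (forall x, P x <-> Q x) -> P = Q.
Proof.
  intros H; apply functional_extensionality; intros x.
  apply propositional_extensionality; apply H.
Qed.

Lemma set_eq a b : (forall x, E x a -> E x b) -> (forall x, E x b -> E x a) -> a = b.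
Proof. intros H1 H2; apply (ext zf); split; auto. Qed.

(** A codomain is supplied so that Separation inside [prod a b] yields the graph; values outside [b]
    are dropped. *)
Definition lam (a b : M) (t : M -> M) : M :=
  sep zf (prod a b) (fun p => exists x, p = pair x (t x)).

#[local] Hint Extern 1 (definableT _ _ _) => progress unfold lam : dfn.

Lemma rel_lam a b t x y : DefF1 E t ->
  (rel E (lam a b t) x y <-> E x a /\ E y b /\ y = t x).
Proof.
  intros Ht; rewrite relP; unfold lam; rewrite (sepP zf) by dfn.
  rewrite in_prod; split.
  - intros [[Hx Hy] [u Hu]]; apply pair_inj in Hu; destruct Hu; subst; auto.
  - intros (Hx & Hy & ->); split; [auto|exists x; reflexivity].
Qed.

Lemma fapp_eq f x y : rel E f x y -> (forall z, rel E f x z -> y = z) -> fapp f x = y.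
Proof. intros H1 H2; apply iota_eq; split; auto. Qed.

Lemma func_lam a b t : DefF1 E t -> (forall x, E x a -> E (t x) b) ->
  func E (lam a b t) (elts E a) (elts E b).
Proof.
  intros Ht H; split.
  - intros p Hp; unfold elts, lam in Hp; rewrite (sepP zf) in Hp by dfn.
    destruct Hp as [Hp _]; apply prodP in Hp; destruct Hp as (x & y & Hx & Hy & ->).
    exists x, y; rewrite opairP; auto.
  - intros x Hx; exists (t x); split.
    + rewrite rel_lam by exact Ht; auto.
    + intros y Hy; rewrite rel_lam in Hy by exact Ht; symmetry; tauto.
Qed.

Lemma fapp_lam a b t x : DefF1 E t -> E x a -> E (t x) b ->
  fapp (lam a b t) x = t x.
Proof.
  intros Ht Hx Hy; apply fapp_eq.
  - rewrite rel_lam by exact Ht; auto.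
  - intros z Hz; rewrite rel_lam in Hz by exact Ht; symmetry; tauto.
Qed.

Lemma func_rel f A B x y : func E f A B -> rel E f x y -> A x /\ B y /\ y = fapp f x.
Proof.
  intros [H1 H2] H.
  assert (Hp : A x /\ B y).
  { apply relP in H; destruct (H1 _ H) as (u & w & Hu & Hw & Hp).
    apply opairP, pair_inj in Hp; destruct Hp; subst; auto. }
  repeat split; [apply Hp|apply Hp|].
  symmetry; apply fapp_eq; [exact H|].
  destruct (H2 x (proj1 Hp)) as (w & _ & Hw).
  intros z Hz; rewrite <- (Hw _ H), <- (Hw _ Hz); reflexivity.
Qed.

Lemma func_fapp f A B x : func E f A B -> A x -> rel E f x (fapp f x) /\ B (fapp f x).
Proof.
  intros Hf Hx; destruct (proj2 Hf x Hx) as (y & Hy & _).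
  destruct (func_rel Hf Hy) as (_ & HB & He); subst y; auto.
Qed.

(** * Natural numbers of the model, ordered by membership *)

Lemma empP x : ~ E x emp.
Proof.
  apply (iotaP zf (P := is_empty E)).
  destruct (zf_infinity zf) as (a & (e & He & _) & _).
  exists e; split; [exact He|]; intros f Hf; apply set_eq; intros y Hy;
    [destruct (He y Hy)|destruct (Hf y Hy)].
Qed.

Lemma is_empty_emp e : is_empty E e <-> e = emp.
Proof.
  split; [|intros ->; exact empP].
  intros He; apply set_eq; intros y Hy; [destruct (He y Hy)|destruct (empP Hy)].
Qed.

Lemma is_succ_succ s n : is_succ E s n <-> s = succ n.
Proof.
  split.
  - intros H; apply (ext zf); intros x; rewrite (H x), succP; reflexivity.
  - intros -> x; apply succP.
Qed.

Lemma omP n : E n om <-> omega E n.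
Proof.
  apply iota_set.
  destruct (zf_infinity zf) as (a & (e & He & Hea) & Ha).
  exists (sep zf a (omega E)); intros x; rewrite (sepP zf) by dfn.
  split; [tauto|]; intros H; split; [|exact H].
  apply H; split.
  - intros e' He'; apply is_empty_emp in He, He'; subst; exact Hea.
  - intros k s Hk Hs; destruct (Ha k Hk) as (s' & Hs' & H').
    apply is_succ_succ in Hs, Hs'; subst; exact H'.
Qed.

Lemma omega_elts : omega E = elts E om.
Proof. apply class_eq; intros x; symmetry; apply omP. Qed.

Lemma om0 : E emp om.
Proof. apply omP; intros a [H _]; apply H; exact empP. Qed.

Lemma omS n : E n om -> E (succ n) om.
Proof.
  rewrite !omP; intros H a Ha; apply (proj2 Ha n); [exact (H a Ha)|].
  apply is_succ_succ; reflexivity.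
Qed.

(** Induction is restricted to definable [P]: minimality of omega is applied to the subset of [om]
    that [P] cuts out, which has to be a set of the model. *)
Lemma om_ind (P : M -> Prop) : Def1 E P -> P emp ->
  (forall n, E n om -> P n -> P (succ n)) -> forall n, E n om -> P n.
Proof.
  intros HP H0 HS n Hn.
  assert (H : E n (sep zf om P)).
  { apply omP in Hn; apply Hn; split.
    - intros e He; apply is_empty_emp in He; subst; rewrite (sepP zf) by dfn.
      split; [exact om0|exact H0].
    - intros k s Hk Hs; apply is_succ_succ in Hs; subst.
      rewrite (sepP zf) in Hk by dfn; rewrite (sepP zf) by dfn.
      destruct Hk; split; [apply omS; assumption|apply HS; assumption]. }
  rewrite (sepP zf) in H by dfn; apply H.
Qed.

Lemma mem_asym x y : E x y -> E y x -> False.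
Proof.
  intros H1 H2.
  destruct (zf_foundation zf (a := upr x y)) as (z & Hz & Hn).
  - intros H; apply (H x); apply uprP; auto.
  - apply Hn; apply uprP in Hz; destruct Hz as [-> | ->].
    + exists y; rewrite uprP; auto.
    + exists x; rewrite uprP; auto.
Qed.

Lemma mem_irrefl x : ~ E x x.
Proof. intros H; exact (mem_asym H H). Qed.

Lemma om_mem n k : E n om -> E k n -> E k om.
Proof.
  intros Hn; revert n Hn k.
  apply (om_ind (P := fun n => forall k, E k n -> E k om)); [dfn| |].
  - intros k Hk; destruct (empP Hk).
  - intros n Hn IH k Hk; apply succP in Hk; destruct Hk as [Hk | ->]; auto.
Qed.

Lemma nat_trans n j k : E n om -> E j k -> E k n -> E j n.
Proof.
  intros Hn; revert n Hn j k.
  apply (om_ind (P := fun n => forall j k, E j k -> E k n -> E j n)); [dfn| |].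
  - intros j k _ Hk; destruct (empP Hk).
  - intros n Hn IH j k Hj Hk; apply succP; apply succP in Hk.
    destruct Hk as [Hk | ->]; eauto.
Qed.

Lemma emp_or_mem n : E n om -> n = emp \/ E emp n.
Proof.
  revert n; apply om_ind; [dfn|auto|].
  intros n Hn [-> | H]; right; apply succP; auto.
Qed.

Lemma succ_mem n k : E n om -> E k n -> succ k = n \/ E (succ k) n.
Proof.
  intros Hn; revert n Hn k.
  apply (om_ind (P := fun n => forall k, E k n -> succ k = n \/ E (succ k) n)); [dfn| |].
  - intros k Hk; destruct (empP Hk).
  - intros n Hn IH k Hk; apply succP in Hk; destruct Hk as [Hk | ->]; [|auto].
    right; apply succP; destruct (IH k Hk); auto.
Qed.

Lemma nat_trichotomy n m : E n om -> E m om -> E n m \/ n = m \/ E m n.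
Proof.
  intros Hn; revert n Hn m.
  apply (om_ind (P := fun n => forall m, E m om -> E n m \/ n = m \/ E m n)); [dfn| |].
  - intros m Hm; destruct (emp_or_mem Hm); auto.
  - intros n Hn IH m Hm; rewrite succP.
    destruct (IH m Hm) as [H|[H|H]]; [|auto|auto].
    destruct (succ_mem Hm H); auto.
Qed.

Lemma succ_inj n m : succ n = succ m -> n = m.
Proof.
  intros H.
  assert (H1 : E n (succ m)) by (rewrite <- H; apply succP; auto).
  assert (H2 : E m (succ n)) by (rewrite H; apply succP; auto).
  apply succP in H1, H2; destruct H1 as [H1|H1], H2 as [H2|H2]; auto.
  destruct (mem_asym H1 H2).
Qed.

Lemma succ_neq_emp n : succ n <> emp.
Proof. intros H; apply (@empP n); rewrite <- H; apply succP; auto. Qed.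

Lemma succ_or_emp n : E n om -> n = emp \/ exists k, E k om /\ n = succ k.
Proof.
  revert n; apply om_ind; [dfn|auto|]; intros n Hn _; right; eauto.
Qed.

Lemma nat_max n m : E n om -> E m om ->
  exists k, E k om /\ (forall i, E i n -> E i k) /\ (forall i, E i m -> E i k).
Proof.
  intros Hn Hm; destruct (nat_trichotomy Hn Hm) as [H|[->|H]].
  - exists m; repeat split; auto; intros i Hi; exact (nat_trans Hm Hi H).
  - exists m; auto.
  - exists n; repeat split; auto; intros i Hi; exact (nat_trans Hn Hi H).
Qed.

End Constructions.

#[export] Hint Resolve DefF2_upr DefF2_pair DefF1_union DefF1_pow DefF1_sing
  DefF2_cup DefF1_succ DefF2_prod DefF2_fapp : dfn.

#[export] Hint Extern 1 (definableT _ _ _) => progress unfold lam : dfn.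

Ltac naturals := repeat first [assumption | apply om0 | apply omS | split].

(** * Dependent choice and countable sets *)

Section DependentChoice.

Context (M : Type) (E : M -> M -> Prop) (zf : ZF E) (dc : DC E).

Local Notation pair := (pair zf).
Local Notation emp := (emp zf).
Local Notation om := (om zf).
Local Notation succ := (succ zf).
Local Notation fapp := (fapp zf).
Local Notation prod := (prod zf).
Local Notation pow := (pow zf).

(* The points from which no sequence starts would themselves satisfy the
   hypothesis of DC. *)
Lemma dc_from (R : M -> M -> Prop) X x0 : Def2 E R -> E x0 X ->
  (forall x, E x X -> exists y, E y X /\ R x y) ->
  exists z, func E z (elts E om) (elts E X) /\ fapp z emp = x0 /\
    forall n, E n om -> R (fapp z n) (fapp z (succ n)).
Proof.
  intros HR Hx0 Htot.
  pose (good := fun x => exists z, func E z (elts E om) (elts E X) /\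
    fapp z emp = x /\ forall n, E n om -> R (fapp z n) (fapp z (succ n))).
  assert (Hgood : Def1 E good) by (unfold good; dfn).
  destruct (classic (good x0)) as [H|Hbad]; [exact H|exfalso].
  pose (Q := sep zf X (fun x => ~ good x)).
  assert (HQ : forall x, E x Q <-> E x X /\ ~ good x)
    by (intros x; unfold Q; rewrite (sepP zf) by dfn; reflexivity).
  pose (S := sep zf (prod X X) (fun p => exists x y, p = pair x y /\ R x y)).
  assert (HS : forall x y, rel E S x y <-> E x X /\ E y X /\ R x y).
  { intros x y; rewrite (relP zf); unfold S; rewrite (sepP zf) by dfn.
    rewrite in_prod; split.
    - intros [[? ?] (u & w & Hu & HR')]; apply pair_inj in Hu; destruct Hu; subst u w; auto.
    - intros (? & ? & ?); split; [auto|exists x, y; auto]. }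
  (* A good successor makes a point good: its sequence is shifted by one place and [x] is put in
     front. *)
  assert (Hback : forall x y, E x X -> R x y -> good y -> good x).
  { intros x y Hx Hxy (z & Hz & Hz0 & HzS).
    pose (t := fun n => iota zf (fun u => (n = emp /\ u = x) \/
      exists k, n = succ k /\ u = fapp z k)).
    assert (Ht : DefF1 E t) by (unfold t; dfn).
    assert (t0 : t emp = x).
    { apply iota_eq; split; [auto|].
      intros u [[_ ->]|(k & Hk & _)]; [reflexivity|].
      destruct (succ_neq_emp (eq_sym Hk)). }
    assert (tS : forall k, t (succ k) = fapp z k).
    { intros k; apply iota_eq; split; [eauto|].
      intros u [[Hk _]|(k' & Hk & ->)]; [destruct (succ_neq_emp Hk)|].
      apply succ_inj in Hk; subst k'; reflexivity. }
    assert (HtX : forall n, E n om -> E (t n) X).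
    { intros n Hn; destruct (succ_or_emp Hn) as [->|(k & Hk & ->)].
      - rewrite t0; exact Hx.
      - rewrite tS; apply (func_fapp zf Hz Hk). }
    exists (lam zf om X t); split; [apply func_lam; assumption|].
    assert (Hl : forall n, E n om -> fapp (lam zf om X t) n = t n)
      by (intros n Hn; apply fapp_lam; auto).
    rewrite Hl by apply om0; split; [exact t0|].
    intros n Hn; rewrite !Hl by (try apply omS; exact Hn).
    destruct (succ_or_emp Hn) as [->|(k & Hk & ->)].
    - rewrite t0, tS, Hz0; exact Hxy.
    - rewrite !tS; apply HzS; exact Hk. }
  destruct (dc (X := Q) (R := S)) as (z & Hz & HzS).
  - exists x0; apply HQ; auto.
  - intros x Hx; apply HQ in Hx; destruct Hx as [Hx Hnx].
    destruct (Htot x Hx) as (y & Hy & Hxy); exists y; rewrite HQ, HS.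
    repeat split; auto; intros Hgy; apply Hnx; exact (Hback x y Hx Hxy Hgy).
  - rewrite (omega_elts zf) in Hz.
    assert (HzQ : forall n, E n om -> E (fapp z n) Q)
      by (intros n Hn; apply (func_fapp zf Hz Hn)).
    destruct (proj1 (HQ _) (HzQ _ (om0 zf))) as [_ Hn]; apply Hn.
    exists z; repeat split.
    + intros p Hp; destruct (proj1 Hz p Hp) as (u & w & Hu & Hw & H).
      exists u, w; repeat split; auto; apply HQ; exact Hw.
    + exact (proj2 Hz).
    + intros n Hn'; assert (HSn := omS Hn').
      assert (H : rel E S (fapp z n) (fapp z (succ n))).
      { apply HzS with n (succ n).
        - apply (omP zf); exact Hn'.
        - apply (is_succ_succ zf); reflexivity.
        - apply (func_fapp zf Hz Hn').
        - apply (func_fapp zf Hz HSn). }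
      apply HS in H; apply H.
Qed.

(** DC is run on pairs of an index and a value. The index component counts the steps, so the
    relation can demand [P] at the next index; the second components form the choice function. *)
Lemma countable_choice (P : M -> M -> Prop) X : Def2 E P ->
  (forall n, E n om -> exists x, E x X /\ P n x) ->
  exists z, func E z (elts E om) (elts E X) /\ forall n, E n om -> P n (fapp z n).
Proof.
  intros HP H.
  destruct (H emp (om0 zf)) as (x0 & Hx0 & HPx0).
  destruct (@dc_from (fun p q => exists n x y, p = pair n x /\ q = pair (succ n) y /\
    P (succ n) y) (prod om X) (pair emp x0)) as (s & Hs & Hs0 & HsS).
  - dfn.
  - apply in_prod; split; [apply om0|exact Hx0].
  - intros p Hp; apply prodP in Hp; destruct Hp as (n & x & Hn & Hx & ->).
    destruct (H _ (omS Hn)) as (y & Hy & HPy).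
    exists (pair (succ n) y); rewrite in_prod; split; [naturals|].
    exists n, x, y; auto.
  - assert (Hx : forall n, E n om ->
      exists x, fapp s n = pair n x /\ E x X /\ P n x).
    { apply om_ind; [dfn| |].
      - exists x0; auto.
      - intros n Hn (x & Hx & _).
        destruct (HsS n Hn) as (n' & x' & y & H1 & H2 & H3).
        rewrite Hx in H1; apply pair_inj in H1; destruct H1; subst n' x'.
        exists y; repeat split; auto.
        assert (Hin := proj2 (func_fapp zf Hs (omS Hn))).
        unfold elts in Hin; rewrite H2 in Hin; apply in_prod in Hin; apply Hin. }
    pose (t := fun n => iota zf (fun x => fapp s n = pair n x)).
    assert (Ht : DefF1 E t) by (unfold t; dfn).
    assert (Htn : forall n, E n om -> E (t n) X /\ P n (t n)).
    { intros n Hn; destruct (Hx n Hn) as (x & Hsx & H').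
      replace (t n) with x; [exact H'|]; symmetry; apply iota_eq; split; [exact Hsx|].
      intros y Hy; rewrite Hsx in Hy; apply pair_inj in Hy; apply Hy. }
    assert (HtX : forall n, E n om -> E (t n) X) by (intros n Hn; apply Htn, Hn).
    exists (lam zf om X t); split.
    + apply func_lam; [exact Ht|exact HtX].
    + intros n Hn; rewrite fapp_lam by auto; apply Htn, Hn.
Qed.

(* Walk along the antidiagonals.  The point [(i, j)] lies on the antidiagonal
   that starts at [(i + j, 0)]. *)
Lemma pairing : exists z, func E z (elts E om) (elts E (prod om om)) /\
  forall i j, E i om -> E j om -> exists n, E n om /\ fapp z n = pair i j.
Proof.
  destruct (@dc_from (fun p q => exists i j, p = pair i j /\
     ((i = emp /\ q = pair (succ j) emp) \/
      exists k, i = succ k /\ q = pair k (succ j)))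
     (prod om om) (pair emp emp)) as (z & Hz & Hz0 & HzS).
  - dfn.
  - apply in_prod; split; apply om0.
  - intros p Hp; apply prodP in Hp; destruct Hp as (i & j & Hi & Hj & ->).
    destruct (succ_or_emp Hi) as [-> | (k & Hk & ->)].
    + exists (pair (succ j) emp); rewrite in_prod; split; [naturals|].
      exists emp, j; auto.
    + exists (pair k (succ j)); rewrite in_prod; split; [naturals|].
      exists (succ k), j; split; [reflexivity|right; eauto].
  - exists z; split; [exact Hz|].
    pose (hit := fun i j => exists n, E n om /\ fapp z n = pair i j).
    assert (Hhit : Def2 E hit) by (unfold hit; dfn).
    assert (step0 : forall j, hit emp j -> hit (succ j) emp).
    { intros j (n & Hn & Hj); exists (succ n); split; [apply omS, Hn|].
      destruct (HzS n Hn) as (i' & j' & H1 & H2); rewrite Hj in H1.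
      apply pair_inj in H1; destruct H1; subst i' j'.
      destruct H2 as [[_ H2]|(k & Hk & _)]; [exact H2|].
      destruct (succ_neq_emp (eq_sym Hk)). }
    assert (stepS : forall i j, hit (succ i) j -> hit i (succ j)).
    { intros i j (n & Hn & Hj); exists (succ n); split; [apply omS, Hn|].
      destruct (HzS n Hn) as (i' & j' & H1 & H2); rewrite Hj in H1.
      apply pair_inj in H1; destruct H1; subst i' j'.
      destruct H2 as [[H2 _]|(k & Hk & H2)]; [destruct (succ_neq_emp H2)|].
      apply succ_inj in Hk; subst k; exact H2. }
    (* [Add i j s] expresses [i + j = s] through a function that counts upwards from [i]. *)
    pose (Add := fun i j s => exists f, func E f (elts E om) (elts E om) /\
      fapp f emp = i /\ (forall n, E n om -> fapp f (succ n) = succ (fapp f n)) /\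
      fapp f j = s).
    assert (HAdd : Def3 E Add) by (unfold Add; dfn).
    assert (Hdiag : forall j, E j om -> forall i s, Add i j s -> hit s emp -> hit i j).
    { apply (om_ind (P := fun j => forall i s, Add i j s -> hit s emp -> hit i j)); [dfn| |].
      - intros i s (f & _ & Hf0 & _ & <-); rewrite Hf0; auto.
      - intros j Hj IH i s (f & Hf & Hf0 & HfS & <-) Hs.
        apply stepS, IH with (fapp f (succ j)); [|exact Hs].
        (* The function shifted by one starts at [succ i], so it witnesses that [succ i] plus [j]
           has the same sum. *)
        assert (Hd : DefF1 E (fun n => fapp f (succ n))) by dfn.
        assert (Hm : forall n, E n om -> E (fapp f (succ n)) om)
          by (intros n Hn; apply (func_fapp zf Hf (omS Hn))).
        assert (Hl : forall n, E n om ->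
          fapp (lam zf om om (fun n => fapp f (succ n))) n = fapp f (succ n))
          by (intros n Hn; rewrite fapp_lam by auto; reflexivity).
        exists (lam zf om om (fun n => fapp f (succ n))); split; [apply func_lam; auto|].
        rewrite !Hl by naturals; rewrite HfS, Hf0 by apply om0.
        repeat split; auto.
        intros n Hn; rewrite !Hl by naturals; apply HfS, omS, Hn. }
    assert (Hadd0 : forall s, E s om -> Add emp s s).
    { intros s Hs; assert (Hd : DefF1 E (fun n => n)) by auto.
      assert (Hl : forall n, E n om -> fapp (lam zf om om (fun n => n)) n = n)
        by (intros n Hn; rewrite fapp_lam by auto; reflexivity).
      exists (lam zf om om (fun n => n)); split; [apply func_lam; auto|].
      rewrite !Hl by naturals; repeat split; auto.
      intros n Hn; rewrite !Hl by naturals; reflexivity. }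
    assert (H0 : forall s, E s om -> hit s emp).
    { apply om_ind; [dfn| |].
      - exists emp; split; [apply om0|exact Hz0].
      - intros s Hs IH; apply step0, Hdiag with s; auto. }
    intros i j Hi Hj; revert j Hj i Hi.
    apply (om_ind (P := fun j => forall i, E i om -> hit i j)); [dfn|exact H0|].
    intros j Hj IH i Hi; apply stepS, IH, omS, Hi.
Qed.

(** The enumeration is partial, so that the empty set qualifies, and may hit more than [S]. It is an
    element of a fixed power set, so that countable choice can select enumerations. *)
Definition countable (G S : M) : Prop :=
  exists e, E e (pow (prod om G)) /\
    (forall n x y, rel E e n x -> rel E e n y -> x = y) /\
    (forall x, E x S -> exists n, rel E e n x).

Lemma def_countable : Def2 E countable.
Proof. unfold countable; dfn. Qed.
#[local] Hint Resolve def_countable : dfn.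

Lemma cover_intro G S (R : M -> M -> Prop) : Def2 E R ->
  (forall n x y, R n x -> R n y -> x = y) ->
  (forall x, E x S -> E x G /\ exists n, E n om /\ R n x) -> countable G S.
Proof.
  intros HR Hf Hc.
  pose (e := sep zf (prod om G) (fun p => exists n x, p = pair n x /\ R n x)).
  assert (He : forall n x, rel E e n x <-> E n om /\ E x G /\ R n x).
  { intros n x; rewrite (relP zf); unfold e; rewrite (sepP zf) by dfn.
    rewrite in_prod; split.
    - intros [[? ?] (u & w & Hu & HR')]; apply pair_inj in Hu; destruct Hu; subst u w; auto.
    - intros (? & ? & ?); split; [auto|exists n, x; auto]. }
  exists e; repeat split.
  - apply powP; intros p Hp; unfold e in Hp; rewrite (sepP zf) in Hp by dfn; apply Hp.
  - intros n x y H1 H2; apply He in H1, H2; apply Hf with n; tauto.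
  - intros x Hx; destruct (Hc x Hx) as (HG & n & Hn & H); exists n; apply He; auto.
Qed.

Lemma cover_dom G e n x : E e (pow (prod om G)) -> rel E e n x -> E n om /\ E x G.
Proof.
  intros He H; apply (relP zf) in H; rewrite powP in He; apply He in H.
  apply in_prod in H; exact H.
Qed.

Lemma countable_sub G S T : countable G S -> (forall x, E x T -> E x S) -> countable G T.
Proof. intros (e & H1 & H2 & H3) H; exists e; auto. Qed.

(** Countable choice picks an enumeration of every [T n] at once; a pairing of omega then codes the
    set index and the position in its enumeration as one number. *)
Lemma countable_union G (T : M -> M) U : DefF1 E T ->
  (forall n, E n om -> countable G (T n)) ->
  (forall x, E x U -> exists n, E n om /\ E x (T n)) -> countable G U.
Proof.
  intros HT Hc HU.
  destruct pairing as (z & Hz & Hzs).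
  destruct (@countable_choice (fun n e =>
    (forall k x y, rel E e k x -> rel E e k y -> x = y) /\
    (forall x, E x (T n) -> exists k, rel E e k x)) (pow (prod om G)))
    as (s & Hs & HsP); [dfn|exact Hc|].
  apply cover_intro with (R := fun n x => exists i j, E i om /\ fapp z n = pair i j /\
    rel E (fapp s i) j x).
  - dfn.
  - intros n x y (i & j & Hi & H1 & H2) (i' & j' & Hi' & H1' & H2').
    rewrite H1 in H1'; apply pair_inj in H1'; destruct H1'; subst i' j'.
    apply (proj1 (HsP i Hi) j); assumption.
  - intros x Hx; destruct (HU x Hx) as (i & Hi & Hxi).
    destruct (proj2 (HsP i Hi) x Hxi) as (j & Hj).
    destruct (cover_dom (proj2 (func_fapp zf Hs Hi)) Hj) as [Hjo HG].
    split; [exact HG|].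
    destruct (Hzs i j Hi Hjo) as (n & Hn & Hp); exists n; split; [exact Hn|].
    exists i, j; auto.
Qed.

Lemma countable_op G (op : M -> M -> M) S T U : DefF2 E op ->
  countable G S -> countable G T ->
  (forall x, E x U -> E x G /\ exists a b, E a S /\ E b T /\ x = op a b) -> countable G U.
Proof.
  intros Hop (e & H1 & H2 & H3) (e' & H1' & H2' & H3') HU.
  destruct pairing as (z & Hz & Hzs).
  apply cover_intro with (R := fun n x => exists i j a b, fapp z n = pair i j /\
    rel E e i a /\ rel E e' j b /\ x = op a b).
  - dfn.
  - intros n x y (i & j & a & b & Hn & Ha & Hb & ->) (i' & j' & a' & b' & Hn' & Ha' & Hb' & ->).
    rewrite Hn in Hn'; apply pair_inj in Hn'; destruct Hn'; subst i' j'.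
    rewrite (H2 _ _ _ Ha Ha'), (H2' _ _ _ Hb Hb'); reflexivity.
  - intros x Hx; destruct (HU x Hx) as (HG & a & b & Ha & Hb & ->).
    split; [exact HG|].
    destruct (H3 a Ha) as (i & Hi), (H3' b Hb) as (j & Hj).
    destruct (Hzs i j) as (n & Hn & Hp);
      [apply (cover_dom H1 Hi)|apply (cover_dom H1' Hj)|].
    exists n; split; [exact Hn|]; exists i, j, a, b; auto.
Qed.

Lemma countable_single G S x : E x G -> (forall y, E y S -> y = x) -> countable G S.
Proof.
  intros Hx H; apply cover_intro with (R := fun n y => y = x).
  - dfn.
  - intros n y z -> ->; reflexivity.
  - intros y Hy; rewrite (H y Hy); split; [exact Hx|exists emp; split; [apply om0|reflexivity]].
Qed.

Lemma countable_union2 G S T U : countable G S -> countable G T ->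
  (forall x, E x U -> E x S \/ E x T) -> countable G U.
Proof.
  intros HS HT HU.
  pose (t := fun n => iota zf (fun u => (n = emp /\ u = S) \/ (n <> emp /\ u = T))).
  assert (Ht : DefF1 E t) by (unfold t; dfn).
  assert (t0 : t emp = S).
  { apply iota_eq; split; [auto|intros u [[_ ->]|[H _]]; [reflexivity|destruct H; reflexivity]]. }
  assert (tS : forall n, n <> emp -> t n = T).
  { intros n Hn; apply iota_eq; split; [auto|].
    intros u [[H _]|[_ ->]]; [destruct (Hn H)|reflexivity]. }
  apply countable_union with (T := t); [exact Ht| |].
  - intros n _; destruct (classic (n = emp)) as [->|Hn]; [rewrite t0|rewrite tS]; auto.
  - intros x Hx; destruct (HU x Hx) as [H|H].
    + exists emp; rewrite t0; split; [apply om0|exact H].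
    + exists (succ emp); rewrite tS by apply succ_neq_emp.
      split; [apply omS, om0|exact H].
Qed.

End DependentChoice.

#[export] Hint Resolve def_countable : dfn.

(** * Groups and free bases *)

Section Groups.

Context (M : Type) (E : M -> M -> Prop) (zf : ZF E) (dc : DC E).

Local Notation pair := (pair zf).
Local Notation emp := (emp zf).
Local Notation om := (om zf).
Local Notation succ := (succ zf).
Local Notation fapp := (fapp zf).
Local Notation prod := (prod zf).
Local Notation pow := (pow zf).

Lemma app2_rel m x y z : app2 E m x y z <-> rel E m (pair x y) z.
Proof.
  unfold app2; split.
  - intros (q & Hq & H); apply (opairP zf) in Hq; subst; exact H.
  - intros H; exists (pair x y); rewrite (opairP zf); auto.
Qed.

Definition mul (m x y : M) : M := iota zf (app2 E m x y).

Lemma DefT_mul m : DefF2 E (mul m).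
Proof. unfold mul; dfn. Qed.
#[local] Hint Resolve DefT_mul : dfn.

Lemma prod_class_elts a b :
  prod_class E (elts E a) (elts E b) = elts E (prod a b).
Proof.
  apply class_eq; intros p; unfold elts at 3; rewrite prodP.
  split; intros (x & y & Hx & Hy & H); exists x, y; repeat split; auto;
    apply (opairP zf); exact H.
Qed.

Section Group.

Context (G m : M) (HG : is_group E G m).

Local Notation "x * y" := (mul m x y).

Lemma mul_fapp x y : x * y = fapp m (pair x y).
Proof.
  apply (f_equal (iota zf)), class_eq; intros z; apply app2_rel.
Qed.

Lemma group_func : func E m (elts E (prod G G)) (elts E G).
Proof. rewrite <- prod_class_elts; apply HG. Qed.

Lemma app2P x y z : app2 E m x y z <-> E x G /\ E y G /\ z = x * y.
Proof.
  rewrite app2_rel, mul_fapp; split.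
  - intros H; apply (func_rel zf group_func) in H; destruct H as (H & _ & ->).
    apply in_prod in H; tauto.
  - intros (Hx & Hy & ->); apply (func_fapp zf group_func).
    apply in_prod; auto.
Qed.

Lemma mulG x y : E x G -> E y G -> E (x * y) G.
Proof.
  intros Hx Hy; rewrite mul_fapp; apply (func_fapp zf group_func).
  apply in_prod; auto.
Qed.

Lemma mulA x y z : E x G -> E y G -> E z G -> (x * y) * z = x * (y * z).
Proof.
  intros Hx Hy Hz; destruct HG as (_ & HA & _).
  assert (H : app2 E m (x * y) z ((x * y) * z))
    by (apply app2P; auto using mulG).
  apply (HA x y z (x * y) (y * z)) in H; [|apply app2P; auto..].
  apply app2P in H; apply H.
Qed.

Definition one : M :=
  iota zf (fun e => E e G /\ forall x, E x G -> e * x = x /\ x * e = x).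
Definition inv (x : M) : M :=
  iota zf (fun y => E y G /\ x * y = one /\ y * x = one).

Lemma one_ex : exists! e, E e G /\ forall x, E x G -> e * x = x /\ x * e = x.
Proof.
  destruct HG as (_ & _ & e & He & H1 & _).
  assert (H : forall x, E x G -> e * x = x /\ x * e = x).
  { intros x Hx; destruct (H1 x Hx) as [Ha Hb]; apply app2P in Ha, Hb.
    split; symmetry; tauto. }
  exists e; split; [auto|].
  intros e' [He' H']; rewrite <- (proj1 (H e' He')); symmetry; apply H', He.
Qed.

Lemma oneG : E one G.
Proof. apply (iotaP zf one_ex). Qed.

Lemma mul1 x : E x G -> one * x = x.
Proof. apply (iotaP zf one_ex). Qed.

Lemma mulr1 x : E x G -> x * one = x.
Proof. apply (iotaP zf one_ex). Qed.

Lemma invP x : E x G -> E (inv x) G /\ x * inv x = one /\ inv x * x = one.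
Proof.
  intros Hx; unfold inv; apply iotaP.
  destruct HG as (_ & _ & e & He & H1 & H2).
  assert (e = one) as ->.
  { destruct (H1 one oneG) as [_ H]; apply app2P in H.
    destruct H as (_ & _ & H); rewrite H at 1.
    rewrite mul1 in H by exact He; rewrite mul1 by exact He; auto. }
  destruct (H2 x Hx) as (y & Hy & Ha & Hb).
  apply app2P in Ha, Hb; exists y; split.
  - repeat split; [exact Hy|symmetry; tauto..].
  - intros z (Hz & Hxz & Hzx).
    rewrite <- (mulr1 Hy), <- Hxz, <- mulA by assumption.
    replace (y * x) with one by tauto; apply mul1, Hz.
Qed.

Lemma invG x : E x G -> E (inv x) G.
Proof. apply invP. Qed.

Lemma mulV x : E x G -> x * inv x = one.
Proof. apply invP. Qed.

Lemma mulVr x : E x G -> inv x * x = one.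
Proof. apply invP. Qed.

Lemma mulI x y z : E x G -> E y G -> E z G -> x * y = x * z -> y = z.
Proof.
  intros Hx Hy Hz H; apply (f_equal (mul m (inv x))) in H.
  rewrite <- !mulA, mulVr, !mul1 in H by auto using invG; exact H.
Qed.

Lemma one_unique x y : E x G -> E y G -> x * y = y -> x = one.
Proof.
  intros Hx Hy H; rewrite <- (mulr1 Hx), <- (mulV Hy), <- mulA, H by auto using invG.
  reflexivity.
Qed.

Lemma invK x : E x G -> inv (inv x) = x.
Proof.
  intros Hx; apply mulI with (inv x); auto using invG.
  rewrite mulV, mulVr by auto using invG; reflexivity.
Qed.

Lemma inv1 : inv one = one.
Proof. rewrite <- (mul1 (invG oneG)); apply mulV, oneG. Qed.

Lemma def_inv : DefF1 E inv.
Proof. unfold inv; dfn. Qed.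

(** Closure under [x * inv y] is the one-step subgroup criterion. With a single operation to
    iterate, [countable_gen] needs only one kind of stage. *)
Definition subgroup (S : M) : Prop :=
  (forall x, E x S -> E x G) /\ E one S /\
  (forall x y, E x S -> E y S -> E (x * inv y) S).

#[local] Hint Resolve def_inv : dfn.
Lemma def_subgroup : Def1 E subgroup.
Proof. unfold subgroup; dfn. Qed.
#[local] Hint Resolve def_subgroup : dfn.

Lemma subgroup_inv S x : subgroup S -> E x S -> E (inv x) S.
Proof.
  intros HS Hx; rewrite <- (mul1 (invG (proj1 HS _ Hx))).
  apply HS; [apply HS|exact Hx].
Qed.

Lemma subgroup_mul S x y : subgroup S -> E x S -> E y S -> E (x * y) S.
Proof.
  intros HS Hx Hy; rewrite <- (invK (proj1 HS _ Hy)).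
  apply HS; [exact Hx|apply subgroup_inv; assumption].
Qed.

Lemma subgroup_one S : subgroup S -> E one S.
Proof. intros HS; exact (proj1 (proj2 HS)). Qed.

Lemma subgroup_sub S x : subgroup S -> E x S -> E x G.
Proof. intros HS; exact (proj1 HS x). Qed.

Lemma subgroup_div S x y : subgroup S -> E x S -> E y S -> E (x * inv y) S.
Proof. intros HS; exact (proj2 (proj2 HS) x y). Qed.

(** Taking the intersection of all subgroups containing [Y] turns an induction over words in the
    generators into the exhibition of a subgroup, as in [gen_min]. *)
Definition gen (Y : M) : M :=
  sep zf G (fun g => forall S, subgroup S -> (forall y, E y Y -> E y S) -> E g S).

Lemma def_gen : DefF1 E gen.
Proof. unfold gen; dfn. Qed.
#[local] Hint Resolve def_gen : dfn.

Lemma genP Y g : E g (gen Y) <->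
  E g G /\ forall S, subgroup S -> (forall y, E y Y -> E y S) -> E g S.
Proof. unfold gen; rewrite (sepP zf) by dfn; reflexivity. Qed.

Lemma gen_subgroup Y : subgroup (gen Y).
Proof.
  repeat split.
  - intros x Hx; apply genP in Hx; exact (proj1 Hx).
  - apply genP; split; [exact oneG|]; intros S HS _; exact (subgroup_one HS).
  - intros x y Hx Hy; apply genP in Hx, Hy; apply genP; split.
    + apply mulG; [|apply invG]; tauto.
    + intros S HS HY; apply subgroup_div; [exact HS|apply Hx|apply Hy]; assumption.
Qed.

Lemma gen_sub Y y : (forall y, E y Y -> E y G) -> E y Y -> E y (gen Y).
Proof. intros HY Hy; apply genP; auto. Qed.

Lemma gen_min Y S : subgroup S -> (forall y, E y Y -> E y S) ->
  forall g, E g (gen Y) -> E g S.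
Proof. intros HS HY g Hg; apply genP in Hg; apply Hg; assumption. Qed.

Lemma gen_mono Y Z : (forall y, E y Y -> E y Z) -> forall g, E g (gen Y) -> E g (gen Z).
Proof.
  intros H g Hg; apply genP in Hg; apply genP; split; [exact (proj1 Hg)|].
  intros S HS HZ; apply Hg; auto.
Qed.

Definition restrict_op (S : M) : M :=
  sep zf m (fun p => exists x y z, p = pair (pair x y) z /\ E x S /\ E y S).

Lemma app2_restrict S x y z :
  app2 E (restrict_op S) x y z <-> E x S /\ E y S /\ app2 E m x y z.
Proof.
  rewrite !app2_rel, !(relP zf); unfold restrict_op; rewrite (sepP zf) by dfn.
  split.
  - intros [Hm (x' & y' & z' & H & Hx & Hy)].
    apply pair_inj in H; destruct H as [H _]; apply pair_inj in H.
    destruct H; subst x' y'; auto.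
  - intros (Hx & Hy & H); split; [exact H|exists x, y, z; auto].
Qed.

Lemma subgroup_group S : subgroup S -> is_group E S (restrict_op S).
Proof.
  intros HS.
  assert (HSG : forall x, E x S -> E x G) by (intros x; apply subgroup_sub, HS).
  assert (H2 : forall x y z, app2 E (restrict_op S) x y z <->
    E x S /\ E y S /\ z = x * y).
  { intros x y z; rewrite app2_restrict, app2P; split; [tauto|].
    intros (Hx & Hy & Hz); repeat split; auto. }
  split; [split|split].
  - intros p Hp.
    assert (Hp' := Hp); unfold elts, restrict_op in Hp.
    rewrite (sepP zf) in Hp by dfn.
    destruct Hp as (_ & x & y & z & -> & Hx & Hy).
    assert (H : app2 E (restrict_op S) x y z) by (apply app2_rel, (relP zf); exact Hp').
    apply H2 in H; destruct H as (_ & _ & ->).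
    exists (pair x y), (x * y); repeat split.
    + exists x, y; rewrite (opairP zf); auto.
    + apply subgroup_mul; assumption.
    + apply (opairP zf); reflexivity.
  - intros q (x & y & Hx & Hy & Hq); apply (opairP zf) in Hq; subst q.
    exists (x * y); split.
    + apply app2_rel, H2; auto.
    + intros z Hz; apply app2_rel, H2 in Hz; symmetry; tauto.
  - intros x y z xy yz t Hxy Hyz; rewrite !H2 in *.
    destruct Hxy as (Hx & Hy & ->), Hyz as (_ & Hz & ->).
    rewrite mulA by auto; split; intros (_ & _ & ->);
      auto using subgroup_mul.
  - exists one; repeat split.
    + exact (subgroup_one HS).
    + apply H2; rewrite mul1 by auto; repeat split; [exact (subgroup_one HS)|assumption].
    + apply H2; rewrite mulr1 by auto; repeat split; [assumption|exact (subgroup_one HS)].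
    + intros x Hx; exists (inv x); rewrite !H2, mulV, mulVr by auto.
      assert (E (inv x) S) by (apply subgroup_inv; assumption); auto.
Qed.

(** The closure is rebuilt from below: starting from [Y] and the unit, each stage adds the quotients
    of the previous one. Every stage is countable, and the stages increase because each contains the
    unit, so their countable union is a subgroup containing [Y]. *)
Lemma countable_gen Y : (forall y, E y Y -> E y G) -> countable zf G Y ->
  countable zf G (gen Y).
Proof.
  intros HY Hc.
  pose (N := fun S => sep zf G (fun g => exists a b, E a S /\ E b S /\ g = a * inv b)).
  assert (HN : DefF1 E N) by (unfold N; dfn).
  assert (NP : forall S g, E g (N S) <->
    E g G /\ exists a b, E a S /\ E b S /\ g = a * inv b)
    by (intros S g; unfold N; rewrite (sepP zf) by dfn; reflexivity).
  pose (X := sep zf (pow G) (countable zf G)).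
  assert (XP : forall S, E S X <-> (forall x, E x S -> E x G) /\ countable zf G S)
    by (intros S; unfold X; rewrite (sepP zf) by dfn; rewrite powP; reflexivity).
  pose (Y1 := cup zf Y (sing zf one)).
  assert (Y1P : forall x, E x Y1 <-> E x Y \/ x = one)
    by (intros x; unfold Y1; rewrite cupP, singP; reflexivity).
  (* The relation is functional, so DC merely iterates [N]. *)
  destruct (@dc_from M E zf dc (fun S T => T = N S) X Y1) as (z & Hz & Hz0 & HzS).
  - dfn.
  - apply XP; split.
    + intros x Hx; apply Y1P in Hx; destruct Hx as [Hx| ->]; [auto|exact oneG].
    + apply countable_union2 with (S := Y) (T := sing zf one); [exact dc|exact Hc| |].
      * apply countable_single with one; [exact oneG|intros y; rewrite singP; auto].
      * intros x Hx; rewrite singP; apply Y1P, Hx.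
  - intros S HS; apply XP in HS; destruct HS as [HS HcS].
    exists (N S); split; [|reflexivity]; apply XP; split.
    + intros x Hx; apply NP in Hx; apply Hx.
    + apply countable_op with (op := fun a b => a * inv b) (S := S) (T := S);
        [exact dc|dfn|exact HcS|exact HcS|].
      intros x Hx; apply NP, Hx.
  - assert (HzX : forall n, E n om -> E (fapp z n) X)
      by (intros n Hn; apply (func_fapp zf Hz Hn)).
    assert (HzG : forall n x, E n om -> E x (fapp z n) -> E x G)
      by (intros n x Hn; apply XP, HzX, Hn).
    assert (H1 : forall n, E n om -> E one (fapp z n)).
    { apply om_ind; [dfn| |].
      - rewrite Hz0; apply Y1P; auto.
      - intros n Hn IH; rewrite (HzS n Hn); apply NP; split; [exact oneG|].
        exists one, one; rewrite inv1, mul1 by exact oneG; auto. }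
    assert (Hs : forall n x, E n om -> E x (fapp z n) -> E x (fapp z (succ n))).
    { intros n x Hn Hx; rewrite (HzS n Hn); apply NP.
      assert (HxG := HzG _ _ Hn Hx); split; [exact HxG|].
      exists x, one; rewrite inv1, mulr1 by exact HxG; auto. }
    assert (Hmono : forall n, E n om -> forall k x, E k n ->
      E x (fapp z k) -> E x (fapp z n)).
    { apply (om_ind (P := fun n => forall k x, E k n -> E x (fapp z k) -> E x (fapp z n)));
        [dfn| |].
      - intros k x Hk; destruct (empP Hk).
      - intros n Hn IH k x Hk Hx; apply succP in Hk; apply Hs; [exact Hn|].
        destruct Hk as [Hk| ->]; eauto. }
    pose (U := sep zf G (fun g => exists n, E n om /\ E g (fapp z n))).
    assert (UP : forall g, E g U <-> exists n, E n om /\ E g (fapp z n)).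
    { intros g; unfold U; rewrite (sepP zf) by dfn; split; [tauto|].
      intros (n & Hn & Hg); split; [exact (HzG n g Hn Hg)|eauto]. }
    apply countable_sub with U.
    + apply countable_union with (T := fapp z); [exact dc|dfn| |].
      * intros n Hn; apply XP, HzX, Hn.
      * intros x Hx; apply UP, Hx.
    + apply gen_min; [repeat split|].
      * intros x Hx; apply UP in Hx; destruct Hx as (n & Hn & Hx); eauto.
      * apply UP; exists emp; split; [apply om0|apply H1, om0].
      * intros x y Hx Hy; apply UP in Hx, Hy.
        destruct Hx as (n & Hn & Hx), Hy as (k & Hk & Hy).
        assert (exists l, E l om /\ E x (fapp z l) /\ E y (fapp z l))
          as (l & Hl & Hxl & Hyl).
        { destruct (nat_trichotomy Hn Hk) as [H|[<-|H]];
            [exists k|exists n|exists n]; eauto. }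
        apply UP; exists (succ l); split; [apply omS, Hl|].
        rewrite (HzS l Hl); apply NP; split; [|exists x, y; auto].
        apply mulG; [|apply invG]; eauto.
      * intros y Hy; apply UP; exists emp; split; [apply om0|].
        rewrite Hz0; apply Y1P; auto.
Qed.

(** * Consequences of the universal property of a free basis *)

Context (X : M) (HX : free_basis E X G m).

Lemma basis_sub x : E x X -> E x G.
Proof. apply HX. Qed.

Lemma func_codomain f A B C : func E f A B -> (forall x, B x -> C x) -> func E f A C.
Proof.
  intros [H1 H2] HBC; split; [|exact H2].
  intros p Hp; destruct (H1 p Hp) as (x & y & Hx & Hy & H).
  exists x, y; auto.
Qed.

(** The inclusion of [X] into [gen X] extends to a homomorphism [h] from [G]. Read with values in
    [G], both [h] and the identity extend the inclusion of [X], so uniqueness makes them equal and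
    [g] is a value of [h]. *)
Lemma basis_gen g : E g G -> E g (gen X).
Proof.
  intros Hg.
  pose (H := gen X).
  assert (HH : subgroup H) by apply gen_subgroup.
  assert (Hid : DefF1 E (fun x : M => x)) by auto.
  assert (HXH : forall x, E x X -> E x H)
    by (intros x Hx; apply gen_sub; [exact basis_sub|exact Hx]).
  destruct (proj2 HX H (restrict_op H) (subgroup_group HH) (lam zf X H (fun x => x)))
    as (h & [[Hh Hhom] Hext] & _); [apply func_lam; assumption|].
  destruct (proj2 HX G m HG (lam zf X G (fun x => x))) as (k & _ & Huniq);
    [apply func_lam; [exact Hid|exact basis_sub]|].
  assert (Hk1 : k = h).
  { apply Huniq; split; [split|].
    - apply func_codomain with (B := elts E H); [exact Hh|intros x; apply (subgroup_sub HH)].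
    - intros x y z x' y' z' Hxyz Hx Hy Hz.
      assert (H' := Hhom _ _ _ _ _ _ Hxyz Hx Hy Hz); apply app2_restrict in H'; apply H'.
    - intros p Hp; apply Hext.
      destruct (proj1 (func_lam zf Hid basis_sub) p Hp) as (x & y & Hx & Hy & He).
      apply (opairP zf) in He; subst p; unfold elts in *.
      apply (relP zf) in Hp; apply (relP zf).
      rewrite rel_lam in Hp by exact Hid; rewrite rel_lam by exact Hid.
      destruct Hp as (_ & _ & ->); auto. }
  assert (HGG : forall x, E x G -> E x G) by auto.
  assert (Hk2 : k = lam zf G G (fun x => x)).
  { apply Huniq; split; [split|].
    - apply func_lam; assumption.
    - intros x y z x' y' z' Hxyz Hx Hy Hz; rewrite rel_lam in Hx, Hy, Hz by exact Hid.
      destruct Hx as (_ & _ & ->), Hy as (_ & _ & ->), Hz as (_ & _ & ->).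
      exact Hxyz.
    - intros p Hp.
      destruct (proj1 (func_lam zf Hid basis_sub) p Hp) as (x & y & Hx & Hy & He).
      apply (opairP zf) in He; subst p; unfold elts in *.
      apply (relP zf) in Hp; apply (relP zf).
      rewrite rel_lam in Hp by exact Hid; rewrite rel_lam by exact Hid.
      destruct Hp as (_ & _ & ->); auto. }
  assert (Hr : rel E h g g) by (rewrite <- Hk1, Hk2, rel_lam by exact Hid; auto).
  apply (func_rel zf Hh Hr).
Qed.

(** The elements lying in some [gen Y] with [Y] countable form a subgroup that contains the basis.
    Countable supports, in place of finite ones, let the closure lemmas for [countable] be
    reused. *)
Lemma countable_support g : E g G -> exists Y, E Y (pow X) /\ countable zf G Y /\ E g (gen Y).
Proof.
  pose (C := sep zf G (fun g => exists Y, E Y (pow X) /\ countable zf G Y /\ E g (gen Y))).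
  assert (CP : forall g, E g C <-> E g G /\
    exists Y, E Y (pow X) /\ countable zf G Y /\ E g (gen Y))
    by (intros x; unfold C; rewrite (sepP zf) by dfn; reflexivity).
  intros Hg; apply basis_gen in Hg; apply CP; revert g Hg; apply gen_min; [repeat split|].
  - intros x Hx; apply CP in Hx; apply Hx.
  - apply CP; split; [exact oneG|]; exists emp; repeat split.
    + apply powP; intros x Hx; destruct (empP Hx).
    + apply countable_single with one; [exact oneG|intros y Hy; destruct (empP Hy)].
    + apply subgroup_one, gen_subgroup.
  - intros x y Hx Hy; apply CP in Hx, Hy.
    destruct Hx as (Hx & Y & HY & HcY & HxY), Hy as (Hy & Z & HZ & HcZ & HyZ).
    apply CP; split; [apply mulG; auto using invG|].
    exists (cup zf Y Z); repeat split.
    + rewrite powP in *; intros t Ht; apply cupP in Ht; destruct Ht; auto.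
    + apply countable_union2 with (S := Y) (T := Z); auto.
      intros t; apply cupP.
    + apply subgroup_div; [apply gen_subgroup|apply gen_mono with Y|apply gen_mono with Z]; auto;
        intros t Ht; apply cupP; auto.
  - intros x Hx; assert (HxG := basis_sub Hx).
    apply CP; split; [exact HxG|]; exists (sing zf x); repeat split.
    + apply powP; intros t Ht; apply singP in Ht; subst; exact Hx.
    + apply countable_single with x; [exact HxG|intros y; rewrite singP; auto].
    + apply gen_sub; [|apply singP; reflexivity].
      intros t Ht; apply singP in Ht; subst; exact HxG.
Qed.

(** The map that is the identity on [Y] and the unit on the rest of [X] extends to a homomorphism
    into [gen Y]. Its fixed points form a subgroup containing [Y], hence include all of [gen Y]. *)
Lemma basis_retract Y : (forall y, E y Y -> E y X) ->
  exists h, (forall g, E g G -> E (fapp h g) (gen Y)) /\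
    (forall x y, E x G -> E y G -> fapp h (x * y) = fapp h x * fapp h y) /\
    (forall g, E g (gen Y) -> fapp h g = g).
Proof.
  intros HY.
  pose (K := gen Y).
  assert (HK : subgroup K) by apply gen_subgroup.
  assert (HYG : forall y, E y Y -> E y G) by (intros; apply basis_sub; auto).
  pose (t := fun x => iota zf (fun u => (E x Y /\ u = x) \/ (~ E x Y /\ u = one))).
  assert (Ht : DefF1 E t) by (unfold t; dfn).
  assert (tY : forall x, E x Y -> t x = x).
  { intros x Hx; apply iota_eq; split; [auto|intros u [[_ ->]|[H _]]; tauto]. }
  assert (tn : forall x, ~ E x Y -> t x = one).
  { intros x Hx; apply iota_eq; split; [auto|intros u [[H _]|[_ ->]]; tauto]. }
  assert (HtK : forall x, E x X -> E (t x) K).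
  { intros x Hx; destruct (classic (E x Y)) as [H|H].
    - rewrite tY by exact H; apply gen_sub; assumption.
    - rewrite tn by exact H; apply subgroup_one, HK. }
  destruct (proj2 HX K (restrict_op K) (subgroup_group HK) (lam zf X K t))
    as (h & [[Hh Hhom] Hext] & _); [apply func_lam; assumption|].
  assert (Hmul : forall x y, E x G -> E y G -> fapp h (x * y) = fapp h x * fapp h y).
  { intros x y Hx Hy.
    assert (H : app2 E (restrict_op K) (fapp h x) (fapp h y) (fapp h (x * y))).
    { apply Hhom with x y (x * y); [apply app2P; auto|..];
        apply (func_fapp zf Hh); unfold elts; auto using mulG. }
    apply app2_restrict in H; destruct H as (_ & _ & H); apply app2P in H; apply H. }
  assert (HhK : forall g, E g G -> E (fapp h g) K)
    by (intros g Hg; apply (func_fapp zf Hh Hg)).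
  exists h; split; [exact HhK|split; [exact Hmul|]].
  assert (Hh1 : fapp h one = one).
  { apply one_unique with (fapp h one); [apply (subgroup_sub HK), HhK, oneG..|].
    rewrite <- Hmul, mul1 by exact oneG; reflexivity. }
  pose (S := sep zf G (fun g => fapp h g = g)).
  assert (SP : forall g, E g S <-> E g G /\ fapp h g = g)
    by (intros g; unfold S; rewrite (sepP zf) by dfn; reflexivity).
  intros g Hg; apply SP; revert g Hg; apply gen_min; [repeat split|].
  - intros x Hx; apply SP in Hx; apply Hx.
  - apply SP; split; [exact oneG|exact Hh1].
  - intros x y Hx Hy; apply SP in Hx, Hy; destruct Hx as [Hx Hhx], Hy as [Hy Hhy].
    apply SP; split; [apply mulG; auto using invG|].
    rewrite Hmul, Hhx by auto using invG; f_equal.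
    (* A fixed point has a fixed inverse: [y * h (inv y)] equals [h (y * inv y)], which is the unit,
       and [y] cancels. *)
    apply mulI with y; auto using invG.
    + apply (subgroup_sub HK), HhK, invG, Hy.
    + rewrite <- Hhy at 1; rewrite <- Hmul, mulV, Hh1 by auto using invG; reflexivity.
  - intros y Hy; apply SP; split; [auto|].
    destruct (func_fapp zf (func_lam zf Ht HtK) (HY _ Hy)) as [Hr _].
    rewrite fapp_lam, tY in Hr by auto.
    assert (Hr' : rel E h y y) by (apply (relP zf), Hext, (relP zf), Hr).
    symmetry; apply (func_rel zf Hh Hr').
Qed.

(** Countable choice picks a countable support for each [t n]. The union of these is a countable
    part of the basis, and the retraction onto the subgroup it generates fixes every [t n]. *)
Lemma countable_retract (t : M -> M) : DefF1 E t -> (forall n, E n om -> E (t n) G) ->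
  exists h K, countable zf G K /\ (forall g, E g G -> E (fapp h g) K) /\
    (forall x, E x K -> E x G) /\
    (forall x y, E x G -> E y G -> fapp h (x * y) = fapp h x * fapp h y) /\
    (forall n, E n om -> fapp h (t n) = t n).
Proof.
  intros Ht HtG.
  destruct (@countable_choice M E zf dc
    (fun n Y => countable zf G Y /\ E (t n) (gen Y)) (pow X)) as (z & Hz & HzP).
  - dfn.
  - intros n Hn; exact (countable_support (HtG n Hn)).
  - pose (Y := sep zf X (fun x => exists n, E n om /\ E x (fapp z n))).
    assert (YP : forall x, E x Y <-> E x X /\ exists n, E n om /\ E x (fapp z n))
      by (intros x; unfold Y; rewrite (sepP zf) by dfn; reflexivity).
    destruct (@basis_retract Y) as (h & HhK & Hmul & Hfix);
      [intros y Hy; apply YP, Hy|].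
    exists h, (gen Y); repeat split; [|exact HhK|intros x; apply subgroup_sub, gen_subgroup|exact Hmul|].
    + apply countable_gen; [intros y Hy; apply basis_sub, YP, Hy|].
      apply countable_union with (T := fapp z); [exact dc|dfn|intros n Hn; apply HzP, Hn|].
      intros x Hx; apply YP, Hx.
    + intros n Hn; apply Hfix.
      apply gen_mono with (fapp z n); [|apply HzP, Hn].
      intros y Hy; apply YP; split; [|eauto].
      assert (Hp := proj2 (func_fapp zf Hz Hn)); unfold elts in Hp.
      rewrite powP in Hp; auto.
Qed.

End Group.

End Groups.

#[export] Hint Resolve DefT_mul def_inv : dfn.

(** * Cantor space *)

Ltac splits := repeat match goal with |- _ /\ _ => split end.

Section CantorSpace.

Context (M : Type) (E : M -> M -> Prop) (zf : ZF E) (dc : DC E).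

Local Notation pair := (pair zf).
Local Notation emp := (emp zf).
Local Notation om := (om zf).
Local Notation succ := (succ zf).
Local Notation fapp := (fapp zf).
Local Notation prod := (prod zf).
Local Notation pow := (pow zf).

Definition two_set : M := upr zf emp (succ emp).
Local Notation tw := two_set.

Lemma twP e : E e tw <-> e = emp \/ e = succ emp.
Proof. apply uprP. Qed.

Lemma two_elts : two E = elts E tw.
Proof.
  apply class_eq; intros e; unfold elts; rewrite twP; unfold two.
  rewrite (is_empty_emp zf); split; intros [H|H]; auto; right.
  - apply (ext zf); intros x; rewrite succP, (H x), (is_empty_emp zf).
    split; [auto|intros [Hx|Hx]; [destruct (empP Hx)|exact Hx]].
  - subst; intros x; rewrite succP, (is_empty_emp zf).
    split; [intros [Hx|Hx]; [destruct (empP Hx)|exact Hx]|auto].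
Qed.

(** This allows basic neighbourhoods to be given by an initial segment of omega in place of an
    arbitrary finite set of coordinates. *)
Lemma finite_bounded c : sub_class (elts E c) (omega E) -> finite E (elts E c) ->
  exists m, E m om /\ forall i, E i c -> E i m.
Proof.
  intros Hc (n & Hn & f & [Hf Hsurj]).
  rewrite (omega_elts zf) in Hc; apply (omP zf) in Hn.
  assert (H : exists m, E m om /\ forall i y, E i n -> rel E f i y -> E y m).
  { assert (Hfo : forall i y, rel E f i y -> E y om)
      by (intros i y Hr; apply Hc, (func_rel zf Hf Hr)).
    assert (Hfu : forall i y y', rel E f i y -> rel E f i y' -> y = y').
    { intros i y y' H H'; apply (func_rel zf Hf) in H, H'.
      destruct H as (_ & _ & ->), H' as (_ & _ & ->); reflexivity. }
    (* Only single-valuedness and the range of [f] are kept, so that the induction can shorten the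
       domain without changing [f]. *)
    clear Hf Hsurj; revert n Hn.
    apply (om_ind (zf := zf) (P := fun n => exists m, E m om /\
      forall i y, E i n -> rel E f i y -> E y m)); [dfn| |].
    - exists emp; split; [apply om0|intros i y Hi; destruct (empP Hi)].
    - intros n Hn (m & Hm & IH).
      destruct (classic (exists y, rel E f n y)) as [[y Hy]|Hno].
      + destruct (nat_max Hm (omS (Hfo _ _ Hy))) as (k & Hk & H1 & H2).
        exists k; split; [exact Hk|]; intros i u Hi Hu; apply succP in Hi.
        destruct Hi as [Hi| ->]; [eauto|].
        rewrite (Hfu _ _ _ Hu Hy); apply H2, succP; auto.
      + exists m; split; [exact Hm|]; intros i u Hi Hu; apply succP in Hi.
        destruct Hi as [Hi| ->]; [eauto|]; destruct Hno; eauto. }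
  destruct H as (m & Hm & H); exists m; split; [exact Hm|].
  intros y Hy; destruct (Hsurj y Hy) as (i & Hi & _).
  apply (H i y); [apply (func_rel zf Hf Hi)|exact Hi].
Qed.

Lemma finite_nat n : E n om -> finite E (elts E n).
Proof.
  intros Hn; exists n; split; [apply (omP zf), Hn|].
  assert (Hid : DefF1 E (fun x : M => x)) by auto.
  exists (lam zf n n (fun x => x)); split; [apply func_lam; auto|].
  intros y Hy; exists y; split.
  - rewrite rel_lam by exact Hid; auto.
  - intros x Hx; rewrite rel_lam in Hx by exact Hid; apply Hx.
Qed.

Definition cantor_set : M := sep zf (pow (prod om tw)) (cantor E).
Local Notation C := cantor_set.

Lemma cantorE x : cantor E x <-> func E x (elts E om) (elts E tw).
Proof.
  unfold cantor; rewrite (omega_elts zf), two_elts; reflexivity.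
Qed.

Lemma cantorP x : E x C <-> cantor E x.
Proof.
  unfold cantor_set; rewrite (sepP zf) by dfn; split; [tauto|].
  intros H; split; [|exact H]; apply powP; intros p Hp.
  apply cantorE in H; destruct (proj1 H p Hp) as (i & e & Hi & He & H').
  apply (opairP zf) in H'; subst; apply in_prod; auto.
Qed.

Lemma agree_trans c x y z : agree_on E c x y -> agree_on E c y z -> agree_on E c x z.
Proof. intros H H' n e Hn; rewrite (H n e Hn); auto. Qed.

Lemma agree_refl c x : agree_on E c x x.
Proof. intros n e _; reflexivity. Qed.

Lemma agree_sub c d x y : (forall i, E i c -> E i d) -> agree_on E d x y -> agree_on E c x y.
Proof. intros H H' n e Hn; auto. Qed.

Lemma open_basic U x : cantor_open E U -> E x U ->
  exists n, E n om /\ forall y, E y C -> agree_on E n x y -> E y U.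
Proof.
  intros [_ HU] Hx; destruct (HU x Hx) as (c & Hc & Hfin & H).
  destruct (finite_bounded Hc Hfin) as (n & Hn & Hcn).
  exists n; split; [exact Hn|]; intros y Hy Ha; apply H; [apply cantorP, Hy|].
  exact (agree_sub Hcn Ha).
Qed.

Definition avoids (N x n : M) : Prop := forall z, E z C -> agree_on E n x z -> ~ E z N.

Lemma def_avoids : Def3 E avoids.
Proof. unfold avoids; dfn. Qed.

(** The basic neighbourhood of [x] is open and nonempty, so it is not inside the closure of [N]; a
    point of it outside the closure has a neighbourhood missing [N]. *)
Lemma nowhere_dense_avoid N x n : nowhere_dense E N -> E x C -> E n om ->
  exists y m, E y C /\ E m om /\ (forall i, E i n -> E i m) /\
    agree_on E n x y /\ avoids N y m.
Proof.
  intros [_ HN] Hx Hn.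
  pose (U := sep zf C (agree_on E n x)).
  assert (UP : forall y, E y U <-> E y C /\ agree_on E n x y)
    by (intros y; unfold U; rewrite (sepP zf) by dfn; reflexivity).
  assert (HU : cantor_open E U).
  { split; [intros y Hy; apply cantorP, UP, Hy|].
    intros y Hy; apply UP in Hy; exists n; split; [|split].
    - intros i Hi; apply (omP zf), (om_mem Hn Hi).
    - apply finite_nat, Hn.
    - intros z Hz Ha; apply UP; split; [apply cantorP, Hz|].
      exact (agree_trans (proj2 Hy) Ha). }
  assert (Hns : ~ sub_class (elts E U) (cantor_closure E N)).
  { intros H; apply (HN U HU H x), UP; split; [exact Hx|apply agree_refl]. }
  apply not_all_ex_not in Hns; destruct Hns as [y Hy].
  apply imply_to_and in Hy; destruct Hy as [Hy Hcl]; apply UP in Hy.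
  apply not_and_or in Hcl; destruct Hcl as [Hcl|Hcl];
    [destruct Hcl; apply cantorP, Hy|].
  apply not_all_ex_not in Hcl; destruct Hcl as [V HV].
  apply imply_to_and in HV; destruct HV as [HV HV'].
  apply imply_to_and in HV'; destruct HV' as [HyV HV'].
  destruct (open_basic HV HyV) as (k & Hk & Hkb).
  destruct (nat_max Hn Hk) as (m & Hm & H1 & H2).
  exists y, m; splits; [apply Hy|exact Hm|exact H1|apply Hy|].
  intros z Hz Ha HzN; apply HV'; exists z; split; [|exact HzN].
  apply Hkb; [exact Hz|exact (agree_sub H2 Ha)].
Qed.

(* [P k x n] says that the [k]-th requirement is met by all points agreeing
   with [x] below [n]. *)
Lemma baire_category (P : M -> M -> M -> Prop) : Def3 E P ->
  (forall k x n, E k om -> E x C -> E n om ->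
    exists y m, E y C /\ E m om /\ (forall i, E i n -> E i m) /\
      agree_on E n x y /\ P k y m) ->
  (forall k x y n, agree_on E n x y -> P k x n -> P k y n) ->
  forall x0 n0, E x0 C -> E n0 om ->
    exists y, E y C /\ agree_on E n0 x0 y /\
      forall k, E k om -> exists m, E m om /\ P k y m.
Proof.
  intros HP Hext Hinv x0 n0 Hx0 Hn0.
  (* A state holds a stage number, a point and a length. The clause [E k m] forces the lengths to
     exhaust omega, so that the limit is defined at every coordinate. *)
  destruct (@dc_from M E zf dc (fun p q => exists k x n y m, p = pair k (pair x n) /\
    q = pair (succ k) (pair y m) /\ (forall i, E i n -> E i m) /\ E k m /\
    agree_on E n x y /\ P k y m) (prod om (prod C om)) (pair emp (pair x0 n0)))
    as (s & Hs & Hs0 & HsS).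
  - dfn.
  - rewrite !in_prod; splits; [apply om0|exact Hx0|exact Hn0].
  - intros p Hp; apply prodP in Hp; destruct Hp as (k & q & Hk & Hq & ->).
    apply prodP in Hq; destruct Hq as (x & n & Hx & Hn & ->).
    destruct (nat_max Hn (omS Hk)) as (l & Hl & H1 & H2).
    destruct (Hext k x l Hk Hx Hl) as (y & m & Hy & Hm & H3 & H4 & H5).
    exists (pair (succ k) (pair y m)); rewrite !in_prod; split; [naturals|].
    exists k, x, n, y, m; splits; auto.
    + apply H3, H2, succP; auto.
    + exact (agree_sub H1 H4).
  - assert (Hst : forall k, E k om -> exists x n, fapp s k = pair k (pair x n)).
    { apply om_ind; [dfn|eauto|].
      intros k Hk (x & n & Hxn).
      destruct (HsS k Hk) as (k' & x' & n' & y & m & H1 & H2 & _).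
      rewrite Hxn in H1; apply pair_inj in H1; destruct H1 as [<- _]; eauto. }
    pose (xs := fun k => iota zf (fun x => exists n, fapp s k = pair k (pair x n))).
    pose (ns := fun k => iota zf (fun n => exists x, fapp s k = pair k (pair x n))).
    assert (Hxs : DefF1 E xs) by (unfold xs; dfn).
    assert (Hns : DefF1 E ns) by (unfold ns; dfn).
    assert (Heq : forall k x n, fapp s k = pair k (pair x n) -> xs k = x /\ ns k = n).
    { intros k x n H; split; apply iota_eq; split; [eauto| |eauto|].
      - intros x' [n' H']; rewrite H in H'; apply pair_inj in H'.
        destruct H' as [_ H']; apply pair_inj in H'; apply H'.
      - intros n' [x' H']; rewrite H in H'; apply pair_inj in H'.
        destruct H' as [_ H']; apply pair_inj in H'; apply H'. }
    assert (HinX : forall k, E k om -> E (xs k) C /\ E (ns k) om).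
    { intros k Hk; destruct (Hst k Hk) as (x & n & H).
      destruct (Heq k x n H) as [-> ->].
      assert (Hin := proj2 (func_fapp zf Hs Hk)); unfold elts in Hin.
      rewrite H, !in_prod in Hin; apply Hin. }
    assert (HS : forall k, E k om -> (forall i, E i (ns k) -> E i (ns (succ k))) /\
      E k (ns (succ k)) /\ agree_on E (ns k) (xs k) (xs (succ k)) /\
      P k (xs (succ k)) (ns (succ k))).
    { intros k Hk; destruct (HsS k Hk) as (k' & x & n & y & m & H1 & H2 & H3).
      assert (k' = k) as ->.
      { destruct (Hst k Hk) as (x' & n' & H); rewrite H in H1; apply pair_inj in H1.
        symmetry; apply H1. }
      destruct (Heq _ _ _ H1) as [-> ->], (Heq _ _ _ H2) as [-> ->]; exact H3. }
    assert (Hmono : forall l, E l om -> forall k, E k l ->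
      (forall i, E i (ns k) -> E i (ns l)) /\ agree_on E (ns k) (xs k) (xs l)).
    { apply (om_ind (zf := zf) (P := fun l => forall k, E k l ->
        (forall i, E i (ns k) -> E i (ns l)) /\ agree_on E (ns k) (xs k) (xs l))); [dfn| |].
      - intros k Hk; destruct (empP Hk).
      - intros l Hl IH k Hk; apply succP in Hk.
        destruct (HS l Hl) as (H1 & _ & H2 & _).
        destruct Hk as [Hk| ->]; [|auto].
        destruct (IH k Hk) as [H3 H4]; split; [auto|].
        exact (agree_trans H4 (agree_sub H3 H2)). }
    (* The limit point is the union of the initial segments fixed along the way. *)
    pose (y := sep zf (prod om tw) (fun p => exists k i e, E k om /\ p = pair i e /\
      E i (ns k) /\ rel E (xs k) i e)).
    assert (Hy : forall i e, rel E y i e <-> exists k, E k om /\ E i (ns k) /\ rel E (xs k) i e).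
    { intros i e; rewrite (relP zf); unfold y; rewrite (sepP zf) by dfn; split.
      - intros (_ & k & i' & e' & Hk & Hp & Hi & Hr); apply pair_inj in Hp.
        destruct Hp; subst i' e'; eauto.
      - intros (k & Hk & Hi & Hr); destruct (HinX k Hk) as [Hx Hn].
        split; [|exists k, i, e; auto].
        apply cantorP, cantorE in Hx; destruct (func_rel zf Hx Hr) as (H1 & H2 & _).
        apply in_prod; auto. }
    assert (Hay : forall k, E k om -> agree_on E (ns k) (xs k) y).
    { intros k Hk i e Hi; rewrite Hy; split; [eauto|].
      intros (l & Hl & Hil & Hr); destruct (nat_trichotomy Hk Hl) as [H|[->|H]].
      - apply (proj2 (Hmono l Hl k H)); assumption.
      - exact Hr.
      - apply (proj2 (Hmono k Hk l H)); assumption. }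
    destruct (Heq _ _ _ Hs0) as [Hxs0 Hns0].
    exists y; split; [|split].
    + apply cantorP, cantorE; split.
      * intros p Hp; unfold elts, y in Hp; rewrite (sepP zf) in Hp by dfn.
        destruct Hp as [Hp _]; apply prodP in Hp; destruct Hp as (i & e & Hi & He & Hp).
        exists i, e; rewrite (opairP zf); auto.
      (* Coordinate [i] is settled from stage [succ i] on. *)
      * intros i Hi; destruct (HS i Hi) as (_ & Hin & _ & _).
        destruct (HinX _ (omS Hi)) as [Hx _]; apply cantorP, cantorE in Hx.
        destruct (proj2 Hx i Hi) as (e & He & Hu); exists e; split.
        -- apply (Hay _ (omS Hi)); assumption.
        -- intros e' He'; apply Hu, (Hay _ (omS Hi)); assumption.
    + rewrite <- Hxs0, <- Hns0; apply Hay, om0.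
    + intros k Hk; exists (ns (succ k)); split; [apply HinX, omS, Hk|].
      destruct (HS k Hk) as (_ & _ & _ & H).
      exact (Hinv _ _ _ _ (Hay _ (omS Hk)) H).
Qed.

(** At coordinate [n] the negation selects the other bit, since values are confined to the
    two-element set. *)
Definition flip (n x : M) : M :=
  sep zf (prod om tw) (fun p => exists k e, p = pair k e /\
    ((k <> n /\ rel E x k e) \/ (k = n /\ ~ rel E x k e))).

Lemma def_flip : DefF2 E flip.
Proof. unfold flip; dfn. Qed.

Lemma rel_flip n x k e : rel E (flip n x) k e <-> E k om /\ E e tw /\
  ((k <> n /\ rel E x k e) \/ (k = n /\ ~ rel E x k e)).
Proof.
  rewrite (relP zf); unfold flip; rewrite (sepP zf) by dfn; rewrite in_prod; split.
  - intros [[Hk He] (k' & e' & H & Hr)]; apply pair_inj in H.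
    destruct H; subst k' e'; auto.
  - intros (Hk & He & H); split; [auto|exists k, e; auto].
Qed.

Lemma flip_cantor n x : E x C -> E (flip n x) C.
Proof.
  intros Hx; apply cantorP, cantorE in Hx; apply cantorP, cantorE; split.
  - intros p Hp; unfold elts, flip in Hp; rewrite (sepP zf) in Hp by dfn.
    destruct Hp as [Hp _]; apply prodP in Hp; destruct Hp as (i & e & Hi & He & Hp).
    exists i, e; rewrite (opairP zf); auto.
  - intros k Hk; destruct (proj2 Hx k Hk) as (e & He & Hu).
    assert (Het : E e tw) by (apply (func_rel zf Hx He)).
    destruct (classic (k = n)) as [->|Hkn].
    + assert (exists e', E e' tw /\ e' <> e /\ forall u, E u tw -> u <> e -> u = e')
        as (e' & He' & Hne & He'u).
      { assert (Hne := @succ_neq_emp M E zf emp).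
        rewrite twP in Het; destruct Het as [-> | ->];
          [exists (succ emp)|exists emp]; rewrite twP; splits; auto;
          intros u; rewrite twP; tauto. }
      exists e'; split.
      * apply rel_flip; splits; auto; right; split; [reflexivity|].
        intros H; apply Hne; symmetry; apply Hu, H.
      * intros u H; apply rel_flip in H; destruct H as (_ & Hut & [[H _]|[_ H]]);
          [destruct H; reflexivity|].
        symmetry; apply He'u; [exact Hut|intros ->; exact (H He)].
    + exists e; split; [apply rel_flip; auto|].
      intros u H; apply rel_flip in H; destruct H as (_ & _ & [[_ H]|[H _]]);
        [apply Hu, H|destruct (Hkn H)].
Qed.

Lemma flip_flip n x : E x C -> flip n (flip n x) = x.
Proof.
  intros Hx; assert (Hx' := Hx); apply cantorP, cantorE in Hx'.
  assert (H : forall k e, rel E (flip n (flip n x)) k e <-> rel E x k e).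
  { intros k e; rewrite !rel_flip; split.
    - intros (Hk & He & H); tauto.
    - intros H; destruct (func_rel zf Hx' H) as (Hk & He & _).
      unfold elts in Hk, He; tauto. }
  apply (set_eq zf); intros p Hp.
  - assert (Hp' := Hp); unfold flip in Hp'; rewrite (sepP zf) in Hp' by dfn.
    destruct Hp' as [Hp' _]; apply prodP in Hp'; destruct Hp' as (k & e & _ & _ & ->).
    apply (relP zf), H, (relP zf), Hp.
  - destruct (proj1 Hx' p Hp) as (k & e & _ & _ & He); apply (opairP zf) in He; subst p.
    apply (relP zf), H, (relP zf), Hp.
Qed.

Lemma flip_agree c n x y : agree_on E c x y -> agree_on E c (flip n x) (flip n y).
Proof. intros H k e Hk; rewrite !rel_flip, (H k e Hk); reflexivity. Qed.

Lemma agree_flip n x : E x C -> agree_on E n x (flip n x).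
Proof.
  intros Hx k e Hk; rewrite rel_flip; apply cantorP, cantorE in Hx.
  split; [|intros (_ & _ & [[_ H]|[-> _]]); [exact H|destruct (mem_irrefl zf Hk)]].
  intros H; destruct (func_rel zf Hx H) as (H1 & H2 & _); splits; auto.
  left; split; [intros ->; exact (mem_irrefl zf Hk)|exact H].
Qed.

#[local] Hint Resolve def_flip def_avoids : dfn.

(** * Use of the Baire property *)

Context (bp : all_baire_property E).

(* If [Y] were comeager in a neighbourhood fixing the coordinates below [n], then
   it would contain some [y] there together with [flip n y]. *)
Lemma independent_meager Y : (forall x, E x Y -> E x C) ->
  (forall n x, E n om -> E x Y -> ~ E (flip n x) Y) ->
  exists F, E F (pow (prod om (pow C))) /\ func E F (elts E om) (nowhere_dense E) /\
    forall x, E x Y -> exists n, E n om /\ E x (fapp F n).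
Proof.
  intros HYC HY.
  destruct (bp (Y := Y)) as (U & D & HU & HD & F & HF & HFD);
    [intros x Hx; apply cantorP, HYC, Hx|].
  rewrite (omega_elts zf) in HF.
  assert (HFP : E F (pow (prod om (pow C)))).
  { apply powP; intros p Hp; destruct (proj1 HF p Hp) as (n & N & Hn & HN & H).
    apply (opairP zf) in H; subst p; apply in_prod; split; [exact Hn|].
    apply powP; intros x Hx; apply cantorP, HN, Hx. }
  (* Once the open set [U] is empty, [Y] is contained in the meager set [D]. *)
  assert (HUe : forall x, ~ E x U).
  { intros x Hx; destruct (open_basic HU Hx) as (n & Hn & Hb).
    assert (HxC : E x C) by (apply cantorP, (proj1 HU), Hx).
    destruct (@baire_category (fun k y m => avoids (fapp F k) y m /\
      avoids (fapp F k) (flip n y) m)) with (x0 := x) (n0 := n)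
      as (y & Hy & Hxy & Hav); [dfn| | |exact HxC|exact Hn|].
    - intros k u l Hk Hu Hl.
      destruct (func_fapp zf HF Hk) as [_ HN].
      destruct (nowhere_dense_avoid HN Hu Hl) as (v & m & Hv & Hm & H1 & H2 & H3).
      (* The second avoidance is carried out around [flip n v]. Flipping the resulting [w] back
         gives a point near [v], which keeps the first avoidance, while its own flip is [w]. *)
      destruct (nowhere_dense_avoid HN (flip_cantor n Hv) Hm)
        as (w & m' & Hw & Hm' & H4 & H5 & H6).
      assert (H7 : agree_on E m v (flip n w)).
      { rewrite <- (flip_flip n Hv); apply flip_agree, H5. }
      exists (flip n w), m'; splits; auto using flip_cantor.
      + exact (agree_trans H2 (agree_sub H1 H7)).
      + intros z Hz Ha; apply H3; [exact Hz|].
        exact (agree_trans H7 (agree_sub H4 Ha)).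
      + rewrite flip_flip by exact Hw; exact H6.
    - intros k u v l Huv [H1 H2]; split; intros z Hz Ha.
      + apply H1; [exact Hz|exact (agree_trans Huv Ha)].
      + apply H2; [exact Hz|exact (agree_trans (flip_agree n Huv) Ha)].
    - assert (HnD : ~ E y D /\ ~ E (flip n y) D).
      { split; intros H; apply HFD in H; destruct H as (k & N & Hr & HN);
          destruct (func_rel zf HF Hr) as (Hk & _ & ->);
          destruct (Hav k Hk) as (m & Hm & H1 & H2).
        - exact (H1 _ Hy (@agree_refl m y) HN).
        - exact (H2 _ (flip_cantor n Hy) (@agree_refl m _) HN). }
      assert (HyU : E y U) by (apply Hb; assumption).
      assert (HfU : E (flip n y) U).
      { apply Hb; [apply flip_cantor, Hy|].
        exact (agree_trans Hxy (@agree_flip n _ Hy)). }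
      assert (HyY : E y Y).
      { apply NNPP; intros H; apply (proj1 HnD), HD; auto. }
      apply (HY n y Hn HyY).
      apply NNPP; intros H; apply (proj2 HnD), HD; auto. }
  exists F; splits; [exact HFP|exact HF|].
  intros x Hx.
  assert (HxD : E x D) by (apply HD; left; auto).
  apply HFD in HxD; destruct HxD as (n & N & Hr & HN).
  destruct (func_rel zf HF Hr) as (Hn & _ & ->); eauto.
Qed.

(** Each colour class contains no two points differing by one flip, so it is meager. The covers of
    the classes are chosen simultaneously, and the category argument yields a point outside all of
    them, although its colour puts it in some class. *)
Lemma no_countable_coloring (G K : M) (col : M -> M) : DefF1 E col ->
  countable zf G K -> (forall x, E x C -> E (col x) K) ->
  (forall n x, E n om -> E x C -> col (flip n x) <> col x) -> False.
Proof.
  intros Hcol (e & He & Hefun & Hecov) HcolK Hflip.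
  pose (Y := fun i => sep zf C (fun x => rel E e i (col x))).
  assert (HY : DefF1 E Y) by (unfold Y; dfn).
  assert (YP : forall i x, E x (Y i) <-> E x C /\ rel E e i (col x))
    by (intros i x; unfold Y; rewrite (sepP zf) by dfn; reflexivity).
  destruct (@countable_choice M E zf dc (fun i F => func E F (elts E om) (nowhere_dense E) /\
    forall x, E x (Y i) -> exists n, E n om /\ E x (fapp F n)) (pow (prod om (pow C))))
    as (s & Hs & HsP).
  - dfn.
  - intros i Hi; apply independent_meager.
    + intros x Hx; exact (proj1 (proj1 (YP i x) Hx)).
    + intros n x Hn H1 H2; apply YP in H1, H2.
      apply (Hflip n x Hn (proj1 H1)), (Hefun i); [apply H2|apply H1].
  - destruct (pairing zf dc) as (z & Hz & Hzs).
    (* Requirement [k] treats the [j]-th nowhere dense set of the [i]-th class when [k] codes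
       [(i, j)]. The length [emp] leaves the start unconstrained. *)
    destruct (@baire_category (fun k y m => forall i j, E i om -> E j om ->
      fapp z k = pair i j -> avoids (fapp (fapp s i) j) y m))
      with (x0 := lam zf om tw (fun _ => emp)) (n0 := emp) as (y & Hy & _ & Hav);
      [dfn| | | |apply om0|].
    + intros k x n Hk Hx Hn.
      assert (Hzk := proj2 (func_fapp zf Hz Hk)); unfold elts in Hzk.
      apply prodP in Hzk; destruct Hzk as (i & j & Hi & Hj & Hp).
      destruct (func_fapp zf (proj1 (HsP i Hi)) Hj) as [_ HN].
      destruct (nowhere_dense_avoid HN Hx Hn) as (u & m & H1 & H2 & H3 & H4 & H5).
      exists u, m; splits; auto.
      intros i' j' _ _ Hp'; rewrite Hp in Hp'; apply pair_inj in Hp'.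
      destruct Hp'; subst i' j'; exact H5.
    + intros k x u n Hxu H i j Hi Hj Hp v Hv Ha.
      apply (H i j Hi Hj Hp v Hv), (agree_trans Hxu Ha).
    + apply cantorP, cantorE, func_lam; [intros; apply defT_const|].
      intros x _; apply twP; auto.
    + destruct (Hecov _ (HcolK y Hy)) as (i & Hi).
      destruct (cover_dom He Hi) as [Hio _].
      destruct (proj2 (HsP i Hio) y) as (j & Hj & Hyj); [apply YP; auto|].
      destruct (Hzs i j Hio Hj) as (k & Hk & Hp).
      destruct (Hav k Hk) as (m & Hm & H).
      exact (H i j Hio Hj Hp y Hy (@agree_refl m y) Hyj).
Qed.

End CantorSpace.

#[export] Hint Resolve def_flip def_avoids : dfn.

(** * Words and parity *)

Section Words.

Context (M : Type) (E : M -> M -> Prop) (zf : ZF E).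

Local Notation pair := (pair zf).
Local Notation emp := (emp zf).
Local Notation om := (om zf).
Local Notation succ := (succ zf).
Local Notation sing := (sing zf).
Local Notation cup := (cup zf).
Local Notation fapp := (fapp zf).
Local Notation prod := (prod zf).
Local Notation pow := (pow zf).
Local Notation tw := (two_set zf).

Lemma has_card_empty (P : M -> Prop) : (forall x, ~ P x) -> has_card E P emp.
Proof.
  intros HP; exists emp; split; [split|].
  - intros p Hp; destruct (empP Hp).
  - intros x Hx; destruct (empP Hx).
  - intros y Hy; destruct (HP y Hy).
Qed.

Lemma has_card_extend (P Q : M -> Prop) k n : E k om -> has_card E P k ->
  ~ P n -> (forall x, Q x <-> P x \/ x = n) -> has_card E Q (succ k).
Proof.
  intros Hk (f & Hf & Hs) Hn HQ.
  pose (f' := cup f (sing (pair k n))).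
  assert (Hf' : forall x y, rel E f' x y <-> rel E f x y \/ (x = k /\ y = n)).
  { intros x y; rewrite !(relP zf); unfold f'; rewrite cupP, singP, pair_eq.
    reflexivity. }
  exists f'; split; [split|].
  - intros p Hp; unfold elts, f' in Hp; rewrite cupP, singP in Hp.
    destruct Hp as [Hp| ->].
    + destruct (proj1 Hf p Hp) as (x & y & Hx & Hy & H); exists x, y.
      splits; [unfold elts in *; apply succP; auto|apply HQ; auto|exact H].
    + exists k, n; splits; [unfold elts in *; apply succP; auto|apply HQ; auto|].
      apply (opairP zf); reflexivity.
  - intros x Hx; unfold elts in Hx; apply succP in Hx; destruct Hx as [Hx| ->].
    + destruct (proj2 Hf x Hx) as (y & Hy & Hu); exists y; split; [apply Hf'; auto|].
      intros z Hz; apply Hf' in Hz; destruct Hz as [Hz|[-> ->]]; [auto|].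
      destruct (mem_irrefl zf Hx).
    + exists n; split; [apply Hf'; auto|].
      intros z Hz; apply Hf' in Hz; destruct Hz as [Hz|[_ ->]]; [|reflexivity].
      destruct (func_rel zf Hf Hz) as [H _]; destruct (mem_irrefl zf H).
  - intros y Hy; apply HQ in Hy; destruct Hy as [Hy| ->].
    + destruct (Hs y Hy) as (x & Hx & Hu); exists x; split; [apply Hf'; auto|].
      intros z Hz; apply Hf' in Hz; destruct Hz as [Hz|[_ ->]]; [auto|].
      destruct (Hn Hy).
    + exists k; split; [apply Hf'; auto|].
      intros z Hz; apply Hf' in Hz; destruct Hz as [Hz|[-> _]]; [|reflexivity].
      destruct (func_rel zf Hf Hz) as (_ & H & _); destruct (Hn H).
Qed.

Lemma finite_sub_nat n A : E n om -> (forall i, E i A -> E i n) -> finite E (elts E A).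
Proof.
  intros Hn; revert n Hn A.
  apply (om_ind (zf := zf) (P := fun n => forall A, (forall i, E i A -> E i n) ->
    finite E (elts E A))); [dfn| |].
  - intros A HA; exists emp; split; [apply (omP zf), om0|].
    apply has_card_empty; intros x Hx; exact (empP (HA x Hx)).
  - intros n Hn IH A HA; destruct (classic (E n A)) as [HnA|HnA].
    + pose (B := sep zf A (fun i => i <> n)).
      assert (BP : forall i, E i B <-> E i A /\ i <> n)
        by (intros i; unfold B; rewrite (sepP zf) by dfn; reflexivity).
      destruct (IH B) as (k & Hk & Hc).
      * intros i Hi; apply BP in Hi; destruct Hi as [Hi Hin].
        apply HA, succP in Hi; tauto.
      * exists (succ k); apply (omP zf) in Hk; split; [apply (omP zf), omS, Hk|].
        apply has_card_extend with (P := elts E B) (n := n); [exact Hk|exact Hc| |].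
        -- intros H; apply BP in H; tauto.
        -- intros x; unfold elts; rewrite BP; split; [|intros [H| ->]; tauto].
           destruct (classic (x = n)); tauto.
    + apply IH; intros i Hi; assert (Hi' := HA i Hi); apply succP in Hi'.
      destruct Hi' as [Hi'| ->]; [exact Hi'|destruct (HnA Hi)].
Qed.

Lemma has_card_single (P : M -> Prop) n : (forall x, P x <-> x = n) ->
  has_card E P (succ emp).
Proof.
  intros HP; apply has_card_extend with (P := elts E emp) (n := n).
  - apply om0.
  - apply has_card_empty; exact (@empP _ _ zf).
  - apply empP.
  - intros x; rewrite HP; unfold elts; split; [auto|].
    intros [H|H]; [destruct (empP H)|exact H].
Qed.

(* For finite [P] this says that [P] has an even number of elements. *)
Definition even (P : M -> Prop) : Prop :=
  exists s,
    (forall x y, rel E s x y -> P x /\ P y /\ x <> y /\ rel E s y x) /\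
    (forall x, P x -> exists y, rel E s x y) /\
    (forall x y z, rel E s x y -> rel E s x z -> y = z).

Lemma even_empty (P : M -> Prop) : (forall x, ~ P x) -> even P.
Proof.
  intros HP; assert (H : forall x y, ~ rel E emp x y)
    by (intros x y; rewrite (relP zf); apply empP).
  exists emp; splits.
  - intros x y Hr; destruct (H x y Hr).
  - intros x Hx; destruct (HP x Hx).
  - intros x y z Hr; destruct (H x y Hr).
Qed.

Lemma not_even_single (P : M -> Prop) n : (forall x, P x <-> x = n) -> ~ even P.
Proof.
  intros HP (s & H1 & H2 & _).
  destruct (H2 n) as [y Hy]; [apply HP; reflexivity|].
  apply H1 in Hy; destruct Hy as (_ & Hy & Hn & _); apply HP in Hy; auto.
Qed.

(** A definable matching becomes a set of the model because [P] lies in omega. *)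
Lemma matching_intro (P : M -> Prop) (S : M -> M -> Prop) : Def2 E S ->
  (forall x, P x -> E x om) ->
  (forall x y, S x y -> P x /\ P y /\ x <> y /\ S y x) ->
  (forall x, P x -> exists y, S x y) ->
  (forall x y z, S x y -> S x z -> y = z) -> even P.
Proof.
  intros HS HPo H1 H2 H3.
  pose (s := sep zf (prod om om) (fun p => exists x y, p = pair x y /\ S x y)).
  assert (Hs : forall x y, rel E s x y <-> S x y).
  { intros x y; rewrite (relP zf); unfold s; rewrite (sepP zf) by dfn.
    rewrite in_prod; split.
    - intros [_ (x' & y' & H & HS')]; apply pair_inj in H; destruct H; subst x' y'.
      exact HS'.
    - intros H; destruct (H1 x y H) as (Hx & Hy & _); split; [auto|].
      exists x, y; auto. }
  exists s; splits.
  - intros x y H; apply Hs in H; rewrite Hs; auto.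
  - intros x Hx; destruct (H2 x Hx) as [y Hy]; exists y; apply Hs, Hy.
  - intros x y z Hy Hz; apply Hs in Hy, Hz; exact (H3 x y z Hy Hz).
Qed.

Lemma even_transfer (P Q : M -> Prop) (T : M -> M -> Prop) : Def2 E T ->
  (forall y, Q y -> E y om) ->
  (forall x, P x -> exists y, Q y /\ T x y) ->
  (forall y, Q y -> exists x, P x /\ T x y) ->
  (forall x y y', T x y -> T x y' -> y = y') ->
  (forall x x' y, T x y -> T x' y -> x = x') -> even P -> even Q.
Proof.
  intros HT HQ HPQ HQP Hf Hi (s & H1 & H2 & H3).
  apply matching_intro with (S := fun y y' => exists x x', T x y /\ T x' y' /\ rel E s x x');
    [dfn|exact HQ| | |].
  - intros y y' (x & x' & Hx & Hx' & Hr).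
    destruct (H1 x x' Hr) as (HPx & HPx' & Hne & Hr').
    destruct (HPQ x HPx) as (u & Hu & HTu), (HPQ x' HPx') as (u' & Hu' & HTu').
    rewrite (Hf _ _ _ Hx HTu), (Hf _ _ _ Hx' HTu'); splits; [exact Hu|exact Hu'| |].
    + intros ->; apply Hne; exact (Hi _ _ _ HTu HTu').
    + exists x', x; auto.
  - intros y Hy; destruct (HQP y Hy) as (x & Hx & HTx).
    destruct (H2 x Hx) as [x' Hr]; destruct (H1 x x' Hr) as (_ & HPx' & _ & _).
    destruct (HPQ x' HPx') as (y' & _ & HTy); exists y', x, x'; auto.
  - intros y u u' (x & w & Hx & Hw & Hr) (x' & w' & Hx' & Hw' & Hr').
    rewrite (Hi _ _ _ Hx' Hx) in Hr'; rewrite (H3 _ _ _ Hr' Hr) in Hw'.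
    exact (Hf _ _ _ Hw Hw').
Qed.

Lemma even_add2 (P Q : M -> Prop) i j : (forall x, P x -> E x om) ->
  P i -> P j -> i <> j -> (forall x, Q x <-> P x /\ x <> i /\ x <> j) ->
  even Q -> even P.
Proof.
  intros HP Hi Hj Hij HQ (s & H1 & H2 & H3).
  assert (HnQ : forall x y, rel E s x y -> x <> i /\ x <> j /\ P x)
    by (intros x y H; apply H1 in H; destruct H as (H & _); apply HQ in H; tauto).
  apply matching_intro with (S := fun x y => rel E s x y \/ (x = i /\ y = j) \/ (x = j /\ y = i));
    [dfn|exact HP| | |].
  - intros x y [H|[[-> ->]|[-> ->]]]; [|splits; auto 6..].
    destruct (H1 x y H) as (Hx & Hy & Hne & Hr); apply HQ in Hx, Hy; tauto.
  - intros x Hx; destruct (classic (x = i)) as [->|Hxi]; [eauto|].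
    destruct (classic (x = j)) as [->|Hxj]; [eauto|].
    destruct (H2 x) as [y Hy]; [apply HQ; auto|eauto].
  - intros x y z [H|[[-> ->]|[-> ->]]] [H'|[[H' ->]|[H' ->]]]; subst;
      try reflexivity; try (destruct Hij; auto; fail);
      repeat match goal with H : rel E s ?x _ |- _ => 
        pose proof (HnQ _ _ H); revert H end; intros; try tauto.
    exact (H3 _ _ _ H H').
Qed.

(* The partners of [i] and [j] are matched with each other. *)
Lemma even_remove2 (P Q : M -> Prop) i j : (forall x, P x -> E x om) ->
  P i -> P j -> i <> j -> (forall x, Q x <-> P x /\ x <> i /\ x <> j) ->
  even P -> even Q.
Proof.
  intros HP Hi Hj Hij HQ (s & H1 & H2 & H3).
  assert (Hsym : forall x y, rel E s x y -> rel E s y x) by (intros x y H; apply H1, H).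
  apply matching_intro with (S := fun x y => x <> i /\ x <> j /\ y <> i /\ y <> j /\
    (rel E s x y \/ (rel E s x i /\ rel E s y j) \/ (rel E s x j /\ rel E s y i)));
    [dfn|intros x Hx; apply HP, HQ, Hx| | |].
  - intros x y (Hxi & Hxj & Hyi & Hyj & H); rewrite !HQ.
    destruct H as [H|[[H H']|[H H']]].
    + destruct (H1 x y H) as (Hx & Hy & Hne & Hr); tauto.
    + destruct (H1 _ _ H) as (Hx & _), (H1 _ _ H') as (Hy & _); splits; try tauto.
      intros ->; apply Hij; exact (H3 _ _ _ H H').
    + destruct (H1 _ _ H) as (Hx & _), (H1 _ _ H') as (Hy & _); splits; try tauto.
      intros ->; apply Hij; exact (H3 _ _ _ H' H).
  - intros x Hx; apply HQ in Hx; destruct Hx as (Hx & Hxi & Hxj).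
    destruct (H2 x Hx) as [y Hy].
    destruct (H2 i Hi) as [i' Hi'], (H2 j Hj) as [j' Hj'].
    (* If the partner of [x] was deleted, the new partner is that of the other deleted point. *)
    destruct (classic (y = i)) as [->|Hyi]; [|destruct (classic (y = j)) as [->|Hyj]].
    + assert (Hj'i : j' <> i).
      { intros ->; apply Hsym in Hj', Hy; apply Hxj; exact (H3 _ _ _ Hy Hj'). }
      exists j'; splits; auto 7.
      intros ->; destruct (H1 _ _ Hj') as (_ & _ & H & _); apply H; reflexivity.
    + assert (Hi'j : i' <> j).
      { intros ->; apply Hsym in Hi', Hy; apply Hxi; exact (H3 _ _ _ Hy Hi'). }
      exists i'; splits; auto 7.
      intros ->; destruct (H1 _ _ Hi') as (_ & _ & H & _); apply H; reflexivity.
    + exists y; splits; auto.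
  - intros x y z (Hxi & Hxj & Hyi & Hyj & H) (_ & _ & Hzi & Hzj & H').
    destruct H as [H|[[H Hy]|[H Hy]]], H' as [H'|[[H' Hz]|[H' Hz]]];
      try (exact (H3 _ _ _ H H'));
      try (destruct Hij; solve [exact (H3 _ _ _ H H')|exact (H3 _ _ _ H' H)]);
      try (exfalso; solve [apply Hyi; exact (H3 _ _ _ H H')|apply Hyj; exact (H3 _ _ _ H H')
        |apply Hzi; exact (H3 _ _ _ H' H)|apply Hzj; exact (H3 _ _ _ H' H)]);
      exact (H3 _ _ _ (Hsym _ _ Hy) (Hsym _ _ Hz)).
Qed.

(** * Words of the model and the parity invariant *)

Definition letters : M := prod om tw.

Lemma letter_elts : letter E = elts E letters.
Proof.
  unfold letter; rewrite (omega_elts zf), (two_elts zf); apply prod_class_elts.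
Qed.

Lemma lettersP n e : E (pair n e) letters <-> E n om /\ E e tw.
Proof. apply in_prod. Qed.

Definition words : M :=
  sep zf (prod (pow (prod om om)) (pow (prod om letters))) (word E).

Lemma wordsP w : E w words <-> word E w.
Proof.
  unfold words; rewrite (sepP zf) by dfn; split; [tauto|].
  intros H; split; [|exact H].
  destruct H as (r & f & d & Hp & Hd & Hf & Hr & _).
  apply (opairP zf) in Hp; subst w; rewrite letter_elts in Hf.
  rewrite (omega_elts zf) in Hd.
  apply in_prod; split; apply powP; intros p H.
  - destruct (proj1 Hr p H) as (x & y & Hx & Hy & Hp); apply (opairP zf) in Hp; subst.
    apply in_prod; split; apply Hd; assumption.
  - destruct (proj1 Hf p H) as (x & y & Hx & Hy & Hp); apply (opairP zf) in Hp; subst.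
    apply in_prod; split; [apply Hd|]; assumption.
Qed.

Lemma wval_pair r f i l : wval E (pair r f) i l <-> rel E f i l.
Proof.
  unfold wval; split.
  - intros (r' & f' & H & Hl); apply (opairP zf), pair_inj in H; destruct H; subst.
    exact Hl.
  - intros H; exists r, f; rewrite (opairP zf); auto.
Qed.

Lemma wlt_pair r f i j : wlt E (pair r f) i j <-> rel E r i j.
Proof.
  unfold wlt; split.
  - intros (r' & f' & H & Hl); apply (opairP zf), pair_inj in H; destruct H; subst.
    exact Hl.
  - intros H; exists r, f; rewrite (opairP zf); auto.
Qed.

Lemma letter_index_pair n e k : E e tw -> (letter_index E (pair n e) k <-> n = k).
Proof.
  intros He; unfold letter_index; rewrite (two_elts zf); split.
  - intros (e' & _ & H); apply (opairP zf), pair_inj in H; apply H.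
  - intros ->; exists e; rewrite (opairP zf); auto.
Qed.

Lemma word_facts w : word E w ->
  (forall i, wdom E w i -> E i om) /\
  (forall i l l', wval E w i l -> wval E w i l' -> l = l') /\
  (forall i, ~ wlt E w i i) /\
  (forall i l, wval E w i l -> exists n e, E n om /\ E e tw /\ l = pair n e).
Proof.
  intros (r & f & d & Hp & Hd & Hf & Hr & _); apply (opairP zf) in Hp; subst w.
  rewrite letter_elts in Hf; rewrite (omega_elts zf) in Hd; splits.
  - intros i [l Hl]; apply wval_pair in Hl; apply Hd, (func_rel zf Hf Hl).
  - intros i l l' H H'; apply wval_pair in H, H'; apply (func_rel zf Hf) in H, H'.
    destruct H as (_ & _ & ->), H' as (_ & _ & ->); reflexivity.
  - intros i H; apply wlt_pair in H; exact (proj1 (proj2 Hr) i H).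
  - intros i l H; apply wval_pair in H; apply (func_rel zf Hf) in H.
    destruct H as (_ & H & _); apply prodP, H.
Qed.

Lemma occurs_om w n i : word E w -> occurs E w n i -> E i om.
Proof. intros Hw (l & Hl & _); apply (word_facts Hw); exists l; exact Hl. Qed.

Lemma occurs_inj w n n' i : word E w -> occurs E w n i -> occurs E w n' i -> n = n'.
Proof.
  intros Hw (l & Hl & Hn) (l' & Hl' & Hn'); destruct (word_facts Hw) as (_ & Hf & _ & Hlet).
  rewrite (Hf _ _ _ Hl' Hl) in Hn'; destruct (Hlet _ _ Hl) as (k & e & _ & He & ->).
  apply letter_index_pair in Hn; [|exact He]; apply letter_index_pair in Hn'; [|exact He].
  congruence.
Qed.

Lemma word_equiv_occurs u v : word_equiv E u v ->
  exists f, bij E f (wdom E u) (wdom E v) /\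
    forall i i' n, rel E f i i' -> (occurs E u n i <-> occurs E v n i').
Proof.
  intros (f & Hf & _ & Hl); exists f; split; [exact Hf|].
  intros i i' n Hr; split; intros (l & H & Hn); exists l; split; auto;
    apply (Hl i i' l Hr); exact H.
Qed.

Lemma occurs_wdom w n i : occurs E w n i -> wdom E w i.
Proof. intros (l & Hl & _); exists l; exact Hl. Qed.

Lemma bij_inj f A B x x' y : bij E f A B -> rel E f x y -> rel E f x' y -> x = x'.
Proof.
  intros [Hf Hs] H H'; destruct (func_rel zf Hf H) as (_ & HB & _).
  destruct (Hs y HB) as (z & _ & Hz); rewrite <- (Hz _ H), <- (Hz _ H'); reflexivity.
Qed.

Lemma func_inj f A B x y y' : func E f A B -> rel E f x y -> rel E f x y' -> y = y'.
Proof.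
  intros Hf H H'; apply (func_rel zf Hf) in H, H'.
  destruct H as (_ & _ & ->), H' as (_ & _ & ->); reflexivity.
Qed.

Lemma word_equiv_even u v n : word E u -> word E v -> word_equiv E u v ->
  (even (occurs E u n) <-> even (occurs E v n)).
Proof.
  intros Hu Hv H; destruct (word_equiv_occurs H) as (f & Hf & Ho).
  assert (H1 : forall x, occurs E u n x -> exists y, occurs E v n y /\ rel E f x y).
  { intros x Hx; destruct (proj2 (proj1 Hf) x (occurs_wdom Hx)) as (y & Hy & _).
    exists y; split; [apply (Ho x y n Hy), Hx|exact Hy]. }
  assert (H2 : forall y, occurs E v n y -> exists x, occurs E u n x /\ rel E f x y).
  { intros y Hy; destruct (proj2 Hf y (occurs_wdom Hy)) as (x & Hx & _).
    exists x; split; [apply (Ho x y n Hx), Hy|exact Hx]. }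
  split.
  - apply even_transfer with (T := rel E f);
      [dfn|intros y; apply (occurs_om Hv)|exact H1|exact H2| |].
    + intros x y y'; apply (func_inj (proj1 Hf)).
    + intros x x' y; apply (bij_inj Hf).
  - apply even_transfer with (T := fun y x => rel E f x y);
      [dfn|intros y; apply (occurs_om Hu)|exact H2|exact H1| |].
    + intros y x x'; apply (bij_inj Hf).
    + intros y y' x; apply (func_inj (proj1 Hf)).
Qed.

Lemma class_even (P Q : M -> Prop) : (forall x, P x <-> Q x) -> (even P <-> even Q).
Proof. intros H; rewrite (class_eq H); reflexivity. Qed.

Lemma restriction_occurs w P v n i : restriction E w P v ->
  (occurs E v n i <-> occurs E w n i /\ P i).
Proof.
  intros (_ & H & _); unfold occurs; split.
  - intros (l & Hl & Hn); apply H in Hl; destruct Hl; split; [exists l; auto|assumption].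
  - intros [(l & Hl & Hn) HP]; exists l; split; [apply H; auto|exact Hn].
Qed.

(** Two mutually inverse letters share their index: a cancellation removes two occurrences of that
    index and none of any other. *)
Lemma cancels_even u v n : word E u -> cancels E u v ->
  (even (occurs E u n) <-> even (occurs E v n)).
Proof.
  intros Hu (i & j & l & l' & Hij & _ & Hl & Hl' & Hinv & Hv).
  assert (Ho : forall x, occurs E v n x <-> occurs E u n x /\ x <> i /\ x <> j)
    by (intros x; apply (restriction_occurs n x Hv)).
  destruct (word_facts Hu) as (_ & _ & Hirr & _).
  assert (Hne : i <> j) by (intros ->; exact (Hirr j Hij)).
  destruct Hinv as (k & e & e' & He & He' & _ & Hlk & Hlk').
  assert (Hi : occurs E u k i) by (exists l; split; [exact Hl|exists e; auto]).
  assert (Hj : occurs E u k j) by (exists l'; split; [exact Hl'|exists e'; auto]).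
  assert (Hom : forall x, occurs E u n x -> E x om) by (intros x; apply (occurs_om Hu)).
  destruct (classic (n = k)) as [->|Hnk].
  - split; [apply even_remove2 with i j|apply even_add2 with i j]; assumption.
  - apply class_even; intros x; rewrite Ho; split; [|tauto].
    intros Hx; splits; [exact Hx|intros ->|intros ->];
      apply Hnk; [exact (occurs_inj Hu Hx Hi)|exact (occurs_inj Hu Hx Hj)].
Qed.

(** This is the homomorphism from HEG to the group of order two that counts [a_n] modulo 2. As
    [free_eq] lies in every equivalence relation closed under its generating steps, it suffices to
    offer the relation of having equal parity, as a set. *)
Lemma word_sim_even u v n : E n om -> word_sim E u v ->
  (even (occurs E u n) <-> even (occurs E v n)).
Proof.
  intros Hn H; destruct (H n) as (u' & v' & Hu & Hv & Hfree); [apply (omP zf), Hn|].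
  (* The projection at level [n] keeps every occurrence of index [n]. *)
  assert (Hp : forall w w', p_ E n w w' -> (even (occurs E w n) <-> even (occurs E w' n))).
  { intros w w' Hw; apply class_even; intros i; rewrite (restriction_occurs n i Hw).
    split; [|tauto]; intros Hi; split; [exact Hi|exists n; auto]. }
  rewrite (Hp u u' Hu), (Hp v v' Hv); clear Hp.
  pose (R := sep zf (prod words words) (fun p => exists x y, p = pair x y /\
    fin_word E n x /\ fin_word E n y /\ (even (occurs E x n) <-> even (occurs E y n)))).
  assert (HR : forall x y, rel E R x y <-> fin_word E n x /\ fin_word E n y /\
    (even (occurs E x n) <-> even (occurs E y n))).
  { intros x y; rewrite (relP zf); unfold R, even; rewrite (sepP zf) by dfn.
    rewrite in_prod, !wordsP; split.
    - intros [_ (x' & y' & He & Hr)]; apply pair_inj in He; destruct He; subst x' y'.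
      exact Hr.
    - intros Hr; split; [|exists x, y; auto].
      destruct Hr as ([Hx _] & [Hy _] & _); auto. }
  assert (Hr : rel E R u' v').
  { apply Hfree.
    - split; [|splits].
      + intros p Hp'; unfold elts, R, even in Hp'; rewrite (sepP zf) in Hp' by dfn.
        destruct Hp' as (_ & x & y & He & Hx & Hy & _); exists x, y.
        rewrite (opairP zf); auto.
      + intros x Hx; apply HR; tauto.
      + intros x y Hxy; apply HR in Hxy; apply HR; tauto.
      + intros x y z Hxy Hyz; apply HR in Hxy, Hyz; apply HR; tauto.
    - intros x y Hx Hy Hxy; apply HR; splits; auto.
      apply word_equiv_even; [apply Hx|apply Hy|exact Hxy].
    - intros x y Hx Hy Hxy; apply HR; splits; auto.
      apply cancels_even; [apply Hx|exact Hxy]. }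
  apply HR, Hr.
Qed.

End Words.

(** * The words [W_A] *)

Section PositiveWords.

Context (M : Type) (E : M -> M -> Prop) (zf : ZF E).

Local Notation pair := (pair zf).
Local Notation emp := (emp zf).
Local Notation om := (om zf).
Local Notation succ := (succ zf).
Local Notation sing := (sing zf).
Local Notation cup := (cup zf).
Local Notation fapp := (fapp zf).
Local Notation prod := (prod zf).
Local Notation pow := (pow zf).
Local Notation tw := (two_set zf).
Local Notation letters := (letters zf).
Local Notation words := (words zf).

(* The word [W_A]. *)
Definition pword (A : M) : M :=
  pair (sep zf (prod A A) (fun p => exists i j, p = pair i j /\ E i j))
    (lam zf A letters (fun n => pair n emp)).

Lemma def_pword : DefF1 E pword.
Proof. unfold pword; dfn. Qed.
#[local] Hint Resolve def_pword : dfn.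

Definition cls (A : M) : M := sep zf words (fun v => word_sim E v (pword A)).

Lemma def_cls : DefF1 E cls.
Proof. unfold cls; dfn. Qed.
#[local] Hint Resolve def_cls : dfn.

Local Notation sub_om A := (forall i, E i A -> E i om).

Lemma emp_tw : E emp tw.
Proof. apply twP; auto. Qed.

Lemma pword_wlt A i j : wlt E (pword A) i j <-> E i A /\ E j A /\ E i j.
Proof.
  unfold pword; rewrite (wlt_pair zf), (relP zf), (sepP zf) by dfn.
  rewrite in_prod; split.
  - intros [[Hi Hj] (i' & j' & H & Hij)]; apply pair_inj in H.
    destruct H; subst i' j'; auto.
  - intros (Hi & Hj & H); split; [auto|exists i, j; auto].
Qed.

Lemma pword_wval A i l : sub_om A -> (wval E (pword A) i l <-> E i A /\ l = pair i emp).
Proof.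
  intros HA; unfold pword; rewrite (wval_pair zf), rel_lam by dfn; split; [tauto|].
  intros [Hi ->]; splits; [exact Hi|apply lettersP; split; [auto|apply emp_tw]|reflexivity].
Qed.

Lemma pword_wdom A i : sub_om A -> (wdom E (pword A) i <-> E i A).
Proof.
  intros HA; unfold wdom; split.
  - intros [l Hl]; apply pword_wval in Hl; [apply Hl|exact HA].
  - intros Hi; exists (pair i emp); apply pword_wval; auto.
Qed.

Lemma pword_occurs A n i : sub_om A -> (occurs E (pword A) n i <-> E i A /\ i = n).
Proof.
  intros HA; unfold occurs; split.
  - intros (l & Hl & Hn); apply pword_wval in Hl; [|exact HA]; destruct Hl as [Hi ->].
    apply (letter_index_pair (zf := zf)) in Hn; [auto|apply emp_tw].
  - intros [Hi ->]; exists (pair n emp); split; [apply pword_wval; auto|].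
    apply letter_index_pair; [apply emp_tw|reflexivity].
Qed.

Lemma pword_occurs_card A n : sub_om A ->
  has_card E (occurs E (pword A) n) emp \/ has_card E (occurs E (pword A) n) (succ emp).
Proof.
  intros HA; destruct (classic (E n A)) as [Hn|Hn].
  - right; apply has_card_single with n; intros x; rewrite pword_occurs by exact HA.
    split; [tauto|intros ->; auto].
  - left; apply has_card_empty; intros x Hx; apply pword_occurs in Hx; [|exact HA].
    destruct Hx as [Hx ->]; exact (Hn Hx).
Qed.

Lemma pword_word A : sub_om A -> word E (pword A).
Proof.
  intros HA; unfold word.
  exists (sep zf (prod A A) (fun p => exists i j, p = pair i j /\ E i j)),
    (lam zf A letters (fun n => pair n emp)), A; splits.
  - apply (opairP zf); reflexivity.
  - rewrite (omega_elts zf); exact HA.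
  - rewrite (letter_elts zf); apply func_lam; [dfn|].
    intros n Hn; apply lettersP; split; [auto|apply emp_tw].
  - assert (Hr : forall i j, rel E (sep zf (prod A A)
      (fun p => exists i j, p = pair i j /\ E i j)) i j <-> E i A /\ E j A /\ E i j).
    { intros i j; rewrite <- pword_wlt; unfold pword; rewrite (wlt_pair zf); reflexivity. }
    split; [|splits].
    + intros p Hp; unfold elts in Hp; rewrite (sepP zf) in Hp by dfn.
      destruct Hp as [Hp _]; apply prodP in Hp; destruct Hp as (i & j & Hi & Hj & Hp).
      exists i, j; rewrite (opairP zf); auto.
    + intros i H; apply Hr in H; exact (mem_irrefl zf (proj2 (proj2 H))).
    + intros i j k H H'; apply Hr in H, H'; apply Hr; splits; try tauto.
      apply (nat_trans (zf := zf)) with j; [apply HA|..]; tauto.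
    + intros i j Hi Hj; rewrite !Hr.
      destruct (nat_trichotomy (HA i Hi) (HA j Hj)) as [H|[H|H]]; auto.
  - intros n _; destruct (pword_occurs_card n HA) as [H|H];
      [exists emp|exists (succ emp)]; (split; [apply (omP zf); naturals|exact H]).
Qed.

Lemma pword_restriction A B (P : M -> Prop) : sub_om A ->
  (forall i, E i B <-> E i A /\ P i) -> restriction E (pword A) P (pword B).
Proof.
  intros HA HB; assert (HBo : sub_om B) by (intros i Hi; apply HA, HB, Hi).
  split; [apply pword_word, HBo|split].
  - intros i l; rewrite !pword_wval by assumption; rewrite HB; tauto.
  - intros i j; rewrite !pword_wlt, !HB; tauto.
Qed.

Lemma pword_equiv_refl A : sub_om A -> word_equiv E (pword A) (pword A).
Proof.
  intros HA; assert (Hid : DefF1 E (fun x : M => x)) by auto.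
  exists (lam zf A A (fun x => x)).
  assert (wdom E (pword A) = elts E A) as ->
    by (apply class_eq; intros i; apply pword_wdom, HA).
  assert (Hl : forall x y, rel E (lam zf A A (fun x => x)) x y <-> E x A /\ x = y).
  { intros x y; rewrite rel_lam by exact Hid; split; [intros (H & _ & ->); auto|].
    intros [H <-]; auto. }
  splits.
  - split; [apply func_lam; auto|].
    intros y Hy; exists y; split; [apply Hl; auto|].
    intros x Hx; apply Hl in Hx; symmetry; apply Hx.
  - intros i j i' j' Hi Hj; apply Hl in Hi, Hj; destruct Hi as [_ <-], Hj as [_ <-].
    reflexivity.
  - intros i i' l Hi; apply Hl in Hi; destruct Hi as [_ <-]; reflexivity.
Qed.

Lemma pword_concat A B D : sub_om D ->
  (forall i, E i D <-> E i A \/ E i B) ->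
  (forall i j, E i A -> E j B -> E i j) -> concat E (pword A) (pword B) (pword D).
Proof.
  intros HD HAB Hlt.
  assert (HA : sub_om A) by (intros i Hi; apply HD, HAB; auto).
  assert (HB : sub_om B) by (intros i Hi; apply HD, HAB; auto).
  split; [apply pword_word, HD|].
  exists A, (pword A), (pword B); splits.
  - intros i j Hi Hj HiA HjA; apply pword_wdom in Hi, Hj; [|exact HD..].
    apply pword_wlt; splits; auto; apply Hlt; [exact HiA|].
    apply HAB in Hj; tauto.
  - apply pword_restriction; [exact HD|]; intros i; unfold elts; rewrite HAB; tauto.
  - apply pword_restriction; [exact HD|]; intros i; rewrite HAB.
    split; [|tauto]; intros Hi; split; [auto|]; intros HiA.
    exact (mem_irrefl zf (Hlt i i HiA Hi)).
  - apply pword_equiv_refl, HA.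
  - apply pword_equiv_refl, HB.
Qed.

(** Reflexivity needs an argument: [word_sim] asks for the projections to exist, and the relations
    in [free_eq] are reflexive on finite words only. The projection of [W_A] is [W_B], where [B] is
    the part of [A] up to [N]. *)
Lemma pword_sim_refl A : sub_om A -> word_sim E (pword A) (pword A).
Proof.
  intros HA N HN; apply (omP zf) in HN.
  pose (B := sep zf A (fun i => E i N \/ i = N)).
  assert (BP : forall i, E i B <-> E i A /\ (E i N \/ i = N))
    by (intros i; unfold B; rewrite (sepP zf) by dfn; reflexivity).
  assert (HB : sub_om B) by (intros i Hi; apply HA, BP, Hi).
  assert (Hp : p_ E N (pword A) (pword B)).
  { apply pword_restriction; [exact HA|]; intros i; rewrite BP; split.
    - intros [Hi H]; split; [exact Hi|]; exists i; split; [|exact H].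
      apply pword_occurs; auto.
    - intros [Hi (n & Hn & H)]; apply pword_occurs in Hn; [|exact HA].
      destruct Hn as [_ ->]; auto. }
  exists (pword B), (pword B); splits; [exact Hp|exact Hp|].
  intros R (_ & HR & _) _ _; apply HR; unfold fin_word; splits.
  - apply pword_word, HB.
  - assert (wdom E (pword B) = elts E B) as ->
      by (apply class_eq; intros i; apply pword_wdom, HB).
    apply finite_sub_nat with (zf := zf) (n := succ N); [apply omS, HN|].
    intros i Hi; apply succP, BP, Hi.
  - intros n i Hn; apply pword_occurs in Hn; [|exact HB]; destruct Hn as [Hi ->].
    apply BP, Hi.
Qed.

Lemma clsP A v : E v (cls A) <-> word E v /\ word_sim E v (pword A).
Proof. unfold cls; rewrite (sepP zf) by dfn; rewrite wordsP; reflexivity. Qed.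

Lemma pword_cls A : sub_om A -> E (pword A) (cls A).
Proof. intros HA; apply clsP; split; [apply pword_word|apply pword_sim_refl]; exact HA. Qed.

Lemma cls_HEG A : sub_om A -> HEG E (cls A).
Proof.
  intros HA; exists (pword A); split; [apply pword_word, HA|].
  intros v; apply clsP.
Qed.

Lemma cls_mul A B D : sub_om D ->
  (forall i, E i D <-> E i A \/ E i B) ->
  (forall i j, E i A -> E j B -> E i j) -> HEG_mul E (cls A) (cls B) (cls D).
Proof.
  intros HD HAB Hlt.
  assert (HA : sub_om A) by (intros i Hi; apply HD, HAB; auto).
  assert (HB : sub_om B) by (intros i Hi; apply HD, HAB; auto).
  unfold HEG_mul; splits; try (apply cls_HEG; assumption).
  exists (pword A), (pword B), (pword D); splits; try (apply pword_cls; assumption).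
  apply pword_concat; assumption.
Qed.

Lemma cls_single_neq n : E n om -> cls (sing n) <> cls emp.
Proof.
  intros Hn H.
  assert (Hs : sub_om (sing n)) by (intros i Hi; apply singP in Hi; subst; exact Hn).
  assert (He : sub_om emp) by (intros i Hi; destruct (empP Hi)).
  assert (Hin := pword_cls Hs); rewrite H in Hin; apply clsP in Hin.
  destruct Hin as [_ Hsim]; apply (word_sim_even Hn) in Hsim.
  apply (@not_even_single _ E (occurs E (pword (sing n)) n) n).
  - intros x; rewrite pword_occurs by exact Hs; rewrite singP; tauto.
  - apply Hsim, (even_empty zf); intros x Hx; apply pword_occurs in Hx; [|exact He].
    destruct (empP (proj1 Hx)).
Qed.

(* A nonempty factor of a word without repeated letters contains some letter
   exactly once, hence is not equivalent to the empty word. *)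
Definition simple_word (w : M) : Prop :=
  forall n i j, occurs E w n i -> occurs E w n j -> i = j.

Lemma restriction_simple w P v : simple_word w -> restriction E w P v -> simple_word v.
Proof.
  intros Hw Hr n i j Hi Hj; apply (restriction_occurs n _ Hr) in Hi, Hj.
  exact (Hw n i j (proj1 Hi) (proj1 Hj)).
Qed.

Lemma equiv_simple u v : word_equiv E u v -> simple_word v -> simple_word u.
Proof.
  intros H Hv; destruct (word_equiv_occurs H) as (f & Hf & Ho).
  intros n i j Hi Hj.
  destruct (proj2 (proj1 Hf) i (occurs_wdom Hi)) as (i' & Hi' & _).
  destruct (proj2 (proj1 Hf) j (occurs_wdom Hj)) as (j' & Hj' & _).
  apply (Ho i i' n Hi') in Hi; apply (Ho j j' n Hj') in Hj.
  rewrite (Hv n j' i' Hj Hi) in Hj'; exact (bij_inj zf Hf Hi' Hj').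
Qed.

Lemma concat_simple u v w : concat E u v w -> simple_word w ->
  simple_word u /\ simple_word v.
Proof.
  intros (_ & s & u' & v' & _ & Hu & Hv & Hu' & Hv') Hw; split.
  - exact (equiv_simple Hu' (restriction_simple Hw Hu)).
  - exact (equiv_simple Hv' (restriction_simple Hw Hv)).
Qed.

Lemma empty_equiv u v : (forall i, ~ wdom E u i) -> (forall i, ~ wdom E v i) ->
  word_equiv E u v.
Proof.
  intros Hu Hv; exists emp.
  assert (He : forall x y, ~ rel E emp x y)
    by (intros x y; rewrite (relP zf); apply empP).
  splits.
  - split; [split|].
    + intros p Hp; destruct (empP Hp).
    + intros x Hx; destruct (Hu x Hx).
    + intros y Hy; destruct (Hv y Hy).
  - intros i j i' j' H; destruct (He _ _ H).
  - intros i i' l H; destruct (He _ _ H).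
Qed.

Lemma simple_reduced w : word E w -> simple_word w -> reduced E w.
Proof.
  intros Hw Hsw; split; [exact Hw|].
  intros u v x uv Hu Hv Hx Huv Huvx e [He Hemp] Hsim.
  assert (Hsv : simple_word v)
    by (apply (concat_simple Huv), (concat_simple Huvx), Hsw).
  apply empty_equiv; [|exact Hemp].
  intros i [l Hl].
  destruct (proj2 (proj2 (proj2 (word_facts zf Hv))) i l Hl) as (n & b & Hn & Hb & ->).
  assert (Hi : occurs E v n i).
  { exists (pair n b); split; [exact Hl|apply letter_index_pair; auto]. }
  apply (word_sim_even Hn) in Hsim.
  apply (@not_even_single _ E (occurs E v n) i).
  - intros j; split; [intros Hj; exact (Hsv n j i Hj Hi)|intros ->; exact Hi].
  - apply Hsim, (even_empty zf); intros j Hj; exact (Hemp j (occurs_wdom Hj)).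
Qed.

Lemma pword_reduced A : sub_om A -> reduced E (pword A).
Proof.
  intros HA; apply simple_reduced; [apply pword_word, HA|].
  intros n i j Hi Hj; apply pword_occurs in Hi, Hj; [|exact HA..].
  destruct Hi as [_ ->], Hj as [_ ->]; reflexivity.
Qed.

Lemma cls_BD A : sub_om A -> BD E (cls A).
Proof.
  intros HA; split; [apply cls_HEG, HA|]; exists (pword A); splits.
  - apply pword_cls, HA.
  - apply pword_reduced, HA.
  (* The bound is strict, so the numeral two covers the cardinalities zero and one. *)
  - exists (succ (succ emp)); split; [apply (omP zf); naturals|].
    intros n _; destruct (pword_occurs_card n HA) as [H|H];
      [exists emp|exists (succ emp)]; (split; [|exact H]); rewrite !succP; auto.
Qed.

Lemma cls_SCAT A : sub_om A -> SCAT E (cls A).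
Proof.
  intros HA; split; [apply cls_HEG, HA|]; exists (pword A); splits.
  - apply pword_cls, HA.
  - apply pword_reduced, HA.
  - intros s Hs Hd.
    assert (HsA : forall i, E i s -> E i A)
      by (intros i Hi; apply pword_wdom; [exact HA|apply Hs, Hi]).
    assert (Hlt : forall i j, E i s -> E j s -> ~ E i j).
    { intros i j Hi Hj Hij.
      (* The domain is well-ordered by membership: a minimal element of [s] above [i] contradicts
         density between it and [i]. *)
      pose (a := sep zf s (fun k => E i k)).
      assert (aP : forall k, E k a <-> E k s /\ E i k)
        by (intros k; unfold a; rewrite (sepP zf) by dfn; reflexivity).
      destruct (zf_foundation zf (a := a)) as (k & Hk & Hmin).
      - intros H; apply (H j), aP; auto.
      - apply aP in Hk; destruct Hk as [Hk Hik].
        destruct (Hd i k Hi Hk) as (t & Ht & H1 & H2); [apply pword_wlt; auto|].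
        apply pword_wlt in H1, H2; apply Hmin; exists t; split; [apply H2|].
        apply aP; split; [exact Ht|apply H1]. }
    intros i j Hi Hj.
    destruct (nat_trichotomy (HA i (HsA i Hi)) (HA j (HsA j Hj))) as [H|[H|H]];
      [destruct (Hlt i j Hi Hj H)|exact H|destruct (Hlt j i Hj Hi H)].
Qed.

End PositiveWords.

#[export] Hint Resolve def_pword def_cls : dfn.

(** * The colouring of Cantor space and the conclusion *)

Section NotFree.

Context (M : Type) (E : M -> M -> Prop) (zf : ZF E) (dc : DC E)
  (bp : all_baire_property E).

Local Notation pair := (pair zf).
Local Notation emp := (emp zf).
Local Notation om := (om zf).
Local Notation succ := (succ zf).
Local Notation sing := (sing zf).
Local Notation cup := (cup zf).
Local Notation fapp := (fapp zf).
Local Notation prod := (prod zf).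
Local Notation pow := (pow zf).
Local Notation cls := (cls zf).
Local Notation C := (cantor_set zf).
Local Notation sub_om A := (forall i, E i A -> E i om).

Definition support (x : M) : M := sep zf om (fun n => rel E x n (succ emp)).

Lemma def_support : DefF1 E support.
Proof. unfold support; dfn. Qed.
#[local] Hint Resolve def_support : dfn.

Lemma supportP x n : E n (support x) <-> E n om /\ rel E x n (succ emp).
Proof. unfold support; rewrite (sepP zf) by dfn; reflexivity. Qed.

Lemma support_flip n x i : E n om -> ~ E n (support x) ->
  (E i (support (flip zf n x)) <-> E i (support x) \/ i = n).
Proof.
  intros Hn Hx; rewrite !supportP, rel_flip; rewrite supportP in Hx.
  assert (E (succ emp) (two_set zf)) by (apply twP; auto).
  destruct (classic (i = n)) as [->|Hi]; tauto.
Qed.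

(** Words are coded on subsets of omega and form a set, and elements of HEG are subsets of it; so
    both the carrier and the multiplication come from Separation. *)
Lemma HEG_part_exists (P : M -> Prop) : Def1 E P -> (forall h, P h -> HEG E h) ->
  exists G m, is_HEG_part E P G m.
Proof.
  intros HP HPH.
  assert (Hw : forall h, HEG E h -> E h (pow (words zf))).
  { intros h (w & _ & Hh); apply powP; intros v Hv; apply wordsP, Hh, Hv. }
  pose (G := sep zf (pow (words zf)) P).
  assert (GP : forall h, E h G <-> P h).
  { intros h; unfold G; rewrite (sepP zf) by dfn; split; [tauto|].
    intros H; split; [apply Hw, HPH, H|exact H]. }
  exists G, (sep zf (prod (prod G G) (pow (words zf))) (fun p => exists q x y z,
    opair E p q z /\ opair E q x y /\ P x /\ P y /\ HEG_mul E x y z)).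
  split; [exact GP|].
  intros p; rewrite (sepP zf) by dfn; split; [tauto|].
  intros H; split; [|exact H]; destruct H as (q & x & y & z & Hp & Hq & Hx & Hy & Hm).
  apply (opairP zf) in Hp, Hq; subst p q; rewrite !in_prod, !GP; splits; auto.
  apply Hw, Hm.
Qed.

(** Only the presence of all classes of the words [W_A] matters, so the argument is the same for BD
    and SCAT. *)
Lemma HEG_part_not_free (P : M -> Prop) G m : (forall A, sub_om A -> P (cls A)) ->
  is_HEG_part E P G m -> ~ is_free_group E G m.
Proof.
  intros HPc [HG Hm] [Hgrp [X HX]].
  assert (HclsG : forall A, sub_om A -> E (cls A) G) by (intros A HA; apply HG; auto).
  assert (Hmul : forall A B D, sub_om D -> (forall i, E i D <-> E i A \/ E i B) ->
    (forall i j, E i A -> E j B -> E i j) -> cls D = mul zf m (cls A) (cls B)).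
  { intros A B D HD HAB Hlt.
    assert (HA : sub_om A) by (intros i Hi; apply HD, HAB; auto).
    assert (HB : sub_om B) by (intros i Hi; apply HD, HAB; auto).
    assert (H : app2 E m (cls A) (cls B) (cls D)).
    { apply (app2_rel zf), (relP zf), Hm.
      exists (pair (cls A) (cls B)), (cls A), (cls B), (cls D); rewrite !(opairP zf).
      splits; auto; apply cls_mul; assumption. }
    apply (app2P zf Hgrp) in H; apply H. }
  assert (He : sub_om emp) by (intros i Hi; destruct (empP Hi)).
  (* The class of the empty word is idempotent, hence the unit. *)
  assert (H1 : cls emp = one zf G m).
  { apply (one_unique Hgrp) with (y := cls emp); auto.
    symmetry; apply Hmul; auto; [intros i; tauto|intros i j Hi; destruct (empP Hi)]. }
  assert (Hsing : forall n, E n om -> sub_om (sing n))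
    by (intros n Hn i Hi; apply singP in Hi; subst; exact Hn).
  destruct (@countable_retract M E zf dc G m Hgrp X HX (fun n => cls (sing n)))
    as (h & K & HcK & HhK & HKG & Hhom & Hfix); [dfn|intros n Hn; apply HclsG, Hsing, Hn|].
  assert (Hcol : forall n A D, E n om -> sub_om A -> ~ E n A ->
    (forall i, E i D <-> E i A \/ i = n) -> fapp h (cls D) <> fapp h (cls A)).
  { intros n A D Hn HA HnA HD Heq.
    assert (HDo : sub_om D) by (intros i Hi; apply HD in Hi; destruct Hi; subst; auto).
    pose (A1 := sep zf A (fun i => E i n)).
    pose (A2 := sep zf A (fun i => E n i)).
    assert (A1P : forall i, E i A1 <-> E i A /\ E i n)
      by (intros i; unfold A1; rewrite (sepP zf) by dfn; reflexivity).
    assert (A2P : forall i, E i A2 <-> E i A /\ E n i)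
      by (intros i; unfold A2; rewrite (sepP zf) by dfn; reflexivity).
    pose (B := cup (sing n) A2).
    assert (BP : forall i, E i B <-> i = n \/ E i A2)
      by (intros i; unfold B; rewrite cupP, singP; reflexivity).
    assert (H1o : sub_om A1) by (intros i Hi; apply HA, A1P, Hi).
    assert (H2o : sub_om A2) by (intros i Hi; apply HA, A2P, Hi).
    assert (HBo : sub_om B) by (intros i Hi; apply BP in Hi; destruct Hi; subst; auto).
    assert (Htri : forall i, E i A -> E i A1 \/ E i A2).
    { intros i Hi; rewrite A1P, A2P.
      destruct (nat_trichotomy (HA i Hi) Hn) as [H|[->|H]]; tauto. }
    assert (EA : cls A = mul zf m (cls A1) (cls A2)).
    { apply Hmul; [exact HA| |].
      - intros i; split; [apply Htri|rewrite A1P, A2P; tauto].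
      - intros i j Hi Hj; apply A1P in Hi; apply A2P in Hj.
        apply (nat_trans (zf := zf)) with n; [apply HA|..]; tauto. }
    assert (EB : cls B = mul zf m (cls (sing n)) (cls A2)).
    { apply Hmul; [exact HBo| |].
      - intros i; rewrite BP, singP; reflexivity.
      - intros i j Hi Hj; apply singP in Hi; subst; apply A2P, Hj. }
    assert (ED : cls D = mul zf m (cls A1) (cls B)).
    { apply Hmul; [exact HDo| |].
      - intros i; rewrite HD, BP; split.
        + intros [Hi|Hi]; [destruct (Htri i Hi); auto|auto].
        + rewrite A1P, A2P; tauto.
      - intros i j Hi Hj; apply A1P in Hi; apply BP in Hj.
        destruct Hj as [->|Hj]; [apply Hi|]; apply A2P in Hj.
        apply (nat_trans (zf := zf)) with n; [apply HA|..]; tauto. }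
    assert (G1 := HclsG A1 H1o); assert (G2 := HclsG A2 H2o).
    assert (GB := HclsG B HBo); assert (Gn := HclsG (sing n) (Hsing n Hn)).
    rewrite EA, ED, !Hhom in Heq by assumption.
    (* Cancelling the image of the part of [A] below [n], then that of the part above, leaves the
       image of [a_n] equal to the unit. The retraction fixes [a_n], and [a_n] is not trivial. *)
    apply (mulI Hgrp) in Heq; auto.
    rewrite EB, Hhom, Hfix in Heq by assumption.
    apply (one_unique Hgrp) in Heq; auto.
    apply (@cls_single_neq M E zf n Hn); rewrite H1; exact Heq. }
  assert (Hso : forall x, sub_om (support x))
    by (intros x i Hi; exact (proj1 (proj1 (supportP x i) Hi))).
  apply (@no_countable_coloring M E zf dc bp G K (fun x => fapp h (cls (support x))));
    [dfn|exact HcK|intros x _; apply HhK, HclsG, Hso|].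
  (* If [n] is already in the support, flipping removes it; since [flip] is an involution, the two
     points exchange roles. *)
  intros n x Hn Hx; destruct (classic (E n (support x))) as [Hnx|Hnx].
  - intros Heq; symmetry in Heq; revert Heq.
    assert (Hn' : ~ E n (support (flip zf n x))).
    { rewrite supportP in *; rewrite rel_flip; tauto. }
    apply Hcol with n; [exact Hn|apply Hso|exact Hn'|].
    intros i; rewrite <- (support_flip i Hn Hn'), flip_flip by exact Hx; reflexivity.
  - apply Hcol with n; [exact Hn|apply Hso|exact Hnx|].
    intros i; apply support_flip; assumption.
Qed.

End NotFree.

Unset Implicit Arguments.

Theorem theorem3p5 (M : Type) (E : M -> M -> Prop) (star : ZF_DC_BP E) :
  (exists G m, is_HEG_part E (BD E) G m /\ ~ is_free_group E G m) /\
  (exists G m, is_HEG_part E (SCAT E) G m /\ ~ is_free_group E G m).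
Proof.
  destruct star as (zf & dc & bp); split.
  - destruct (@HEG_part_exists M E zf (BD E)) as (G & m & H); [dfn|intros h Hh; apply Hh|].
    exists G, m; split; [exact H|].
    exact (HEG_part_not_free dc bp (@cls_BD M E zf) H).
  - destruct (@HEG_part_exists M E zf (SCAT E)) as (G & m & H); [dfn|intros h Hh; apply Hh|].
    exists G, m; split; [exact H|].
    exact (HEG_part_not_free dc bp (@cls_SCAT M E zf) H).
Qed.
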